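(* Let $T=(k^\times)^r$ be an algebraic torus over $k$. There exists a model structure on $(\mathtt{DGA}_k^+)^T$ with the following properties: (1) Weak equivalences (resp. fibrations) are exactly the maps that are weak equivalences (resp. fibrations) under the forgetful functor $U:(\mathtt{DGA}_k^+)^T\to\mathtt{DGA}_k^+$ (and cofibrations are the maps with the left lifting property with respect to the acyclic fibrations defined in this way). (2) The forgetful functor $U$ preserves cofibrations.
   Context: $k$ is an algebraically closed field of characteristic $0$. $\mathtt{DGA}_k^+$ is the category of non-negatively graded unital associative dg $k$-algebras (differentials of degree $-1$), with the projective model structure: weak equivalences are quasi-isomorphisms, fibrations are maps surjective in all positive degrees. A rational action of an algebraic group $T$ on $A\in\mathtt{DGA}_k^+$ is a group homomorphism $T\to\mathrm{Aut}_{\mathtt{DGA}_k^+}(A)$ such that every $a\in A$ lies in a finite-dimensional $T$-stable subspace $V\subset A$ on which the induced action $T\to\mathrm{GL}_k(V)$ is a morphism of algebraic groups. $(\mathtt{DGA}_k^+)^T$ is the category of objects of $\mathtt{DGA}_k^+$ with a rational $T$-action and $T$-equivariant morphisms. *)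

(* Defs.v *)
From HB Require Import structures.
From mathcomp Require Import all_boot all_algebra.
From mathcomp Require Import boolp.

Set Implicit Arguments.
Unset Strict Implicit.
Unset Printing Implicit Defensive.

Import GRing.Theory.
Local Open Scope ring_scope.

Record category := Category {
  ob :> Type;
  mor : ob -> ob -> Type;
  idm : forall X, mor X X;
  mcomp : forall X Y Z, mor Y Z -> mor X Y -> mor X Z;
  mcomp1m : forall X Y (f : mor X Y), mcomp (idm Y) f = f;
  mcompm1 : forall X Y (f : mor X Y), mcomp f (idm X) = f;
  mcompA : forall X Y Z W (h : mor Z W) (g : mor Y Z) (f : mor X Y),
    mcomp h (mcomp g f) = mcomp (mcomp h g) f
}.

Arguments mor {c} X Y.
Arguments idm {c} X.
Arguments mcomp {c X Y Z} g f.

Notation "g \c f" := (mcomp g f) (at level 50, left associativity).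

Record functor (C D : category) := Functor {
  fob :> C -> D;
  fmap : forall X Y, mor X Y -> mor (fob X) (fob Y);
  fmap1 : forall X, fmap (idm X) = idm (fob X);
  fmapM : forall X Y Z (g : mor Y Z) (f : mor X Y),
    fmap (g \c f) = fmap g \c fmap f
}.

Definition morphism_class (C : category) := forall X Y : C, mor X Y -> Prop.

Section CategoryNotions.
Variable C : category.

Definition lifts (A B X Y : C) (i : mor A B) (p : mor X Y) : Prop :=
  forall (u : mor A X) (v : mor B Y), p \c u = v \c i ->
    exists h : mor B X, h \c i = u /\ p \c h = v.

Definition llp (P : morphism_class C) : morphism_class C :=
  fun A B i => forall (X Y : C) (p : mor X Y), P X Y p -> lifts i p.

Definition meet_class (P Q : morphism_class C) : morphism_class C :=
  fun X Y f => P X Y f /\ Q X Y f.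

Definition retract_of (X Y X' Y' : C) (f : mor X Y) (g : mor X' Y') : Prop :=
  exists (i : mor X X') (r : mor X' X) (j : mor Y Y') (s : mor Y' Y),
    [/\ r \c i = idm X, s \c j = idm Y, g \c i = j \c f & f \c r = s \c g].

Definition retract_closed (P : morphism_class C) : Prop :=
  forall (X Y X' Y' : C) (f : mor X Y) (g : mor X' Y'),
    retract_of f g -> P X' Y' g -> P X Y f.

Definition wide_subcategory (P : morphism_class C) : Prop :=
  (forall X : C, P X X (idm X)) /\
  (forall (X Y Z : C) (g : mor Y Z) (f : mor X Y),
     P Y Z g -> P X Y f -> P X Z (g \c f)).

Definition two_of_three (P : morphism_class C) : Prop :=
  forall (X Y Z : C) (g : mor Y Z) (f : mor X Y),
    [/\ P X Y f -> P Y Z g -> P X Z (g \c f),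
        P X Y f -> P X Z (g \c f) -> P Y Z g
      & P Y Z g -> P X Z (g \c f) -> P X Y f].

Definition factors (P Q : morphism_class C) : Prop :=
  forall (X Y : C) (f : mor X Y), exists (Z : C) (i : mor X Z) (p : mor Z Y),
    [/\ P X Z i, Q Z Y p & p \c i = f].

(** Diagrams are shaped by small directed graphs.  A functor from a small
    category is such a diagram on the underlying graph, with the same cones
    and cocones; conversely a graph diagram extends uniquely to the free
    category on the graph. *)
Record diagram := Diagram {
  vertex : Type;
  edge : vertex -> vertex -> Type;
  dob :> vertex -> C;
  dmor : forall i j, edge i j -> mor (dob i) (dob j)
}.

Definition is_cone (D : diagram) (X : C) (p : forall i, mor X (D i)) : Prop :=
  forall i j (e : @edge D i j), dmor e \c p i = p j.

Definition is_cocone (D : diagram) (X : C) (q : forall i, mor (D i) X) : Prop :=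
  forall i j (e : @edge D i j), q j \c dmor e = q i.

Definition has_limit (D : diagram) : Prop :=
  exists (L : C) (p : forall i, mor L (D i)), is_cone p /\
    forall (X : C) (q : forall i, mor X (D i)), is_cone q ->
      exists! h : mor X L, forall i, p i \c h = q i.

Definition has_colimit (D : diagram) : Prop :=
  exists (L : C) (p : forall i, mor (D i) L), is_cocone p /\
    forall (X : C) (q : forall i, mor (D i) X), is_cocone q ->
      exists! h : mor L X, forall i, h \c p i = q i.

Record model_structure := ModelStructure {
  weq : morphism_class C;
  fib : morphism_class C;
  cof : morphism_class C;
  ms_complete : forall D : diagram, has_limit D;
  ms_cocomplete : forall D : diagram, has_colimit D;
  ms_weq_sub : wide_subcategory weq;
  ms_fib_sub : wide_subcategory fib;
  ms_cof_sub : wide_subcategory cof;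
  ms_two_of_three : two_of_three weq;
  ms_weq_retract : retract_closed weq;
  ms_fib_retract : retract_closed fib;
  ms_cof_retract : retract_closed cof;
  ms_lift_cof_acyclic_fib :
    forall (A B X Y : C) (i : mor A B) (p : mor X Y),
      cof i -> meet_class fib weq p -> lifts i p;
  ms_lift_acyclic_cof_fib :
    forall (A B X Y : C) (i : mor A B) (p : mor X Y),
      meet_class cof weq i -> fib p -> lifts i p;
  ms_factor_cof_acyclic_fib : factors cof (meet_class fib weq);
  ms_factor_acyclic_cof_fib : factors (meet_class cof weq) fib
}.

End CategoryNotions.

Section DGA.
Variable k : fieldType.

(** Unital associative algebras; the library's [algType] excludes the zero
    algebra, which is the terminal object of the category of dg algebras. *)
Record algebra := Algebra {
  alg_car :> lmodType k;
  amul : alg_car -> alg_car -> alg_car;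
  aone : alg_car;
  amulA : forall x y z, amul x (amul y z) = amul (amul x y) z;
  amul1x : forall x, amul aone x = x;
  amulx1 : forall x, amul x aone = x;
  amulPl : forall z, linear (fun x => amul x z);
  amulPr : forall z, linear (amul z)
}.

Local Notation "x * y" := (amul x y) : ring_scope.
Local Notation "1" := (aone _) : ring_scope.

(** The underlying algebra is the total one, the direct sum over [n] of the
    subspaces [homog n] of elements of degree [n]. *)
Record dga := Dga {
  dga_car :> algebra;
  homog : nat -> dga_car -> Prop;
  dga_diff : {linear dga_car -> dga_car};
  homog0 : forall n, homog n 0;
  homogP : forall n (a : k) x y, homog n x -> homog n y -> homog n (a *: x + y);
  homog_span : forall x, exists (n : nat) (c : nat -> dga_car),
    (forall i, homog i (c i)) /\ x = \sum_(i < n) c i;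
  homog_direct : forall (n : nat) (c : nat -> dga_car),
    (forall i, homog i (c i)) -> \sum_(i < n) c i = 0 ->
    forall i, (i < n)%N -> c i = 0;
  homog1 : homog 0 1;
  homogM : forall i j x y, homog i x -> homog j y -> homog (i + j) (x * y);
  dga_diff_homog0 : forall x, homog 0 x -> dga_diff x = 0;
  dga_diff_homogS : forall n x, homog n.+1 x -> homog n (dga_diff x);
  dga_diffK : forall x, dga_diff (dga_diff x) = 0;
  dga_diffM : forall i x y, homog i x ->
    dga_diff (x * y) = dga_diff x * y + (-1)%R ^+ i *: (x * dga_diff y)
}.

Record dga_hom (A B : dga) := DgaHom {
  dga_fun :> A -> B;
  dga_funL : linear dga_fun;
  dga_fun1 : dga_fun 1 = 1;
  dga_funM : forall x y, dga_fun (x * y) = dga_fun x * dga_fun y;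
  dga_fun_homog : forall n x, homog n x -> homog n (dga_fun x);
  dga_fun_diff : forall x, dga_fun (dga_diff A x) = dga_diff B (dga_fun x)
}.

Lemma dga_homP (A B : dga) (f g : dga_hom A B) : f =1 g -> f = g.
Proof.
case: f g => [f f1 f2 f3 f4 f5] [g g1 g2 g3 g4 g5] /= /funext efg.
by rewrite efg in f1 f2 f3 f4 f5 *; congr DgaHom; apply: Prop_irrelevance.
Qed.

Definition dga_id (A : dga) : dga_hom A A.
Proof. by apply: (@DgaHom A A id). Defined.

Definition dga_comp (A B C : dga) (g : dga_hom B C) (f : dga_hom A B) :
  dga_hom A C.
Proof.
apply: (@DgaHom A C (g \o f)) => [a x y||x y|n x Hx|x] /=.
- by rewrite !dga_funL.
- by rewrite !dga_fun1.
- by rewrite !dga_funM.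
- by do 2 apply: dga_fun_homog.
- by rewrite !dga_fun_diff.
Defined.

Definition DGA : category.
Proof.
apply: (@Category dga dga_hom dga_id dga_comp) => *; exact: dga_homP.
Defined.

Definition dga_cycle (A : dga) n (x : A) : Prop := homog n x /\ dga_diff A x = 0.

Definition dga_boundary (A : dga) n (x : A) : Prop :=
  exists2 y : A, homog n.+1 y & dga_diff A y = x.

(** Injectivity and surjectivity of [H_n(f) : H_n(A) -> H_n(B)] for all [n],
    where [H_n] is [dga_cycle n] modulo [dga_boundary n]. *)
Definition dga_weq : morphism_class DGA := fun (A B : dga) (f : dga_hom A B) =>
  forall n,
    (forall x, dga_cycle n x -> dga_boundary n (f x) -> dga_boundary n x) /\
    (forall y, dga_cycle n y -> exists2 x, dga_cycle n x & dga_boundary n (f x - y)).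

Definition dga_fib : morphism_class DGA := fun (A B : dga) (f : dga_hom A B) =>
  forall n, (0 < n)%N -> forall y, homog n y -> exists2 x, homog n x & f x = y.

Definition dga_cof : morphism_class DGA := llp (meet_class dga_fib dga_weq).

End DGA.

Section Torus.
Variables (k : fieldType) (r : nat).

Record torus := Torus {
  tcoord :> {ffun 'I_r -> k};
  tcoord_neq0 : [forall i, tcoord i != 0]
}.

HB.instance Definition _ := [isSub for tcoord].
HB.instance Definition _ := [Choice of torus by <:].

Lemma torus_oneP : [forall i, [ffun _ : 'I_r => 1 : k] i != 0].
Proof. by apply/forallP => i; rewrite ffunE oner_neq0. Qed.

Lemma torus_mulP (s t : torus) : [forall i, [ffun i => s i * t i] i != 0].
Proof.
apply/forallP => i; rewrite ffunE mulf_neq0 //.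
  by have /forallP := tcoord_neq0 s.
by have /forallP := tcoord_neq0 t.
Qed.

Lemma torus_invP (t : torus) : [forall i, [ffun i => (t i)^-1] i != 0].
Proof.
by apply/forallP => i; rewrite ffunE invr_eq0; have /forallP := tcoord_neq0 t.
Qed.

Definition torus_one := Torus torus_oneP.
Definition torus_mul (s t : torus) := Torus (torus_mulP s t).
Definition torus_inv (t : torus) := Torus (torus_invP t).

Lemma torus_mulA : associative torus_mul.
Proof. by move=> s t u; apply/val_inj/ffunP => i; rewrite !ffunE mulrA. Qed.

Lemma torus_mulC : commutative torus_mul.
Proof. by move=> s t; apply/val_inj/ffunP => i; rewrite !ffunE mulrC. Qed.

Lemma torus_mul1 : left_id torus_one torus_mul.
Proof. by move=> t; apply/val_inj/ffunP => i; rewrite !ffunE mul1r. Qed.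

Lemma torus_mulV : left_inverse torus_one torus_inv torus_mul.
Proof.
move=> t; apply/val_inj/ffunP => i; rewrite !ffunE mulVf //.
by have /forallP := tcoord_neq0 t.
Qed.

Lemma torus_mulr1 : right_id torus_one torus_mul.
Proof. by move=> t; rewrite torus_mulC torus_mul1. Qed.

Lemma torus_mulrV : right_inverse torus_one torus_inv torus_mul.
Proof. by move=> t; rewrite torus_mulC torus_mulV. Qed.

HB.instance Definition _ := isGroup.Build torus
  torus_mulA torus_mul1 torus_mulr1 torus_mulV torus_mulrV.

(** The coordinate ring of the torus is the ring of Laurent polynomials
    [k[t_0^{+-1}, ..., t_{r-1}^{+-1}]]; a Laurent polynomial is given by a
    list of pairs (coefficient, exponent). *)
Definition torus_regular (f : torus -> k) : Prop :=
  exists s : seq (k * {ffun 'I_r -> int}),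
    forall t, f t = \sum_(m <- s) m.1 * \prod_i t i ^ m.2 i.

(** [e] is a basis of a stable subspace of [V], and [rho] the action on it
    in this basis.  A map to the open subvariety [GL_m] of the affine space of
    matrices is a morphism iff its entries are regular. *)
Definition rational_action (V : lmodType k) (act : torus -> V -> V) : Prop :=
  forall a : V, exists (m : nat) (e : 'I_m -> V) (rho : torus -> 'M[k]_m),
    [/\ forall c : 'I_m -> k, \sum_i c i *: e i = 0 -> forall i, c i = 0,
        exists c : 'I_m -> k, a = \sum_i c i *: e i,
        forall t j, act t (e j) = \sum_i rho t i j *: e i,
        forall t, rho t \in unitmx
      & forall i j, torus_regular (fun t => rho t i j)].

(** The two group laws make every [tact t] an automorphism, with inverse
    [tact t^-1]. *)
Record tdga := Tdga {
  tdga_dga :> dga k;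
  tact : torus -> dga_hom tdga_dga tdga_dga;
  tact1 : tact 1%g = dga_id tdga_dga;
  tactM : forall s t, tact (s * t)%g = dga_comp (tact s) (tact t);
  tact_rational : rational_action (fun t => tact t)
}.

Record tdga_hom (A B : tdga) := TdgaHom {
  tdga_fun :> dga_hom A B;
  tdga_funT : forall t x, tdga_fun (tact A t x) = tact B t (tdga_fun x)
}.

Lemma tdga_homP (A B : tdga) (f g : tdga_hom A B) :
  tdga_fun f = tdga_fun g -> f = g.
Proof.
case: f g => [f f1] [g g1] /= efg.
by rewrite efg in f1 *; congr TdgaHom; apply: Prop_irrelevance.
Qed.

Definition tdga_id (A : tdga) : tdga_hom A A.
Proof. by apply: (@TdgaHom A A (dga_id A)). Defined.

Definition tdga_comp (A B C : tdga) (g : tdga_hom B C) (f : tdga_hom A B) :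
  tdga_hom A C.
Proof.
by apply: (@TdgaHom A C (dga_comp g f)) => t x /=; rewrite !tdga_funT.
Defined.

Definition DGAT : category.
Proof.
apply: (@Category tdga tdga_hom tdga_id tdga_comp) => *;
  by apply: tdga_homP; apply: dga_homP.
Defined.

Definition forgetT : functor DGAT (DGA k).
Proof.
exact: (@Functor DGAT (DGA k) tdga_dga (fun A B => @tdga_fun A B)).
Defined.

End Torus.

(* Main.v *)
From HB Require Import structures.
Require Import Defs.
From mathcomp Require Import all_boot all_algebra.
From mathcomp Require Import boolp functions.

(** Characters of the torus [T] are linearly independent, so a rational
    [T]-action on a dg algebra is the same as a grading by the weight lattice
    (lemmas [tdga_bispan] and [pre_tdga]): every element is a finite sum of
    bihomogeneous elements, of some degree [n] and some weight [w].  Hence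
    solutions of homogeneous lifting problems can be made equivariant by taking
    weight components, and a map is an acyclic fibration iff it lifts
    bihomogeneous data against the boundaries of cells ([acyclic_lifting]).

    All the objects needed are built by one construction, [generated_exists].
    Given a family of algebras [X i] (possibly indexed by a proper class) and
    unary operations with bihomogeneous values on all of them, it yields the
    subalgebra of the product generated by the operations.  Its elements are
    formal terms modulo having equal values in every [X i]; as such a relation
    lives in [Prop], the result is small however large the family is.  Every
    identity valid in the [X i] holds in it for free.
    - Limits are generated by the compatible families of bihomogeneous elements
      ([family_limit_exists]).
    - The algebra generated inside the class of all models of some structure is
      the initial model ([initial_model_exists]).  Colimits are the case where
      the structure is a cocone.

    Both factorizations of [f : A -> B] are initial models, in the spirit of
    the algebraic small object argument: no transfinite composition occurs.
    - For (cofibration, acyclic fibration), a model is an algebra between [A]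
      and [B] with a chosen solution of every lifting problem that defines an
      acyclic fibration.  The initial model [Z] thus maps to [B] by an acyclic
      fibration.  It lifts against any acyclic fibration [X -> Y] because the
      pullback of [X] along [Z -> Y] is again a model, so that initiality gives
      a section of it.
    - For (acyclic cofibration, fibration), adjoin freely to [A] an element over
      each bihomogeneous [b] of positive degree in [B]; a differential is
      adjoined with it.  Killing the new elements retracts the result onto [A],
      and the retraction is a homotopy inverse: the homotopy is a map to the path
      algebra of triples [(x, b, y)], and to define it one only has to give
      its values on generators.
    The remaining lifting property follows by the retract argument.

    The forgetful functor preserves cofibrations because it has a right adjoint,
    the coinduced algebra of functions [T -> C], which preserves acyclic
    fibrations ([coinduced_acyclic_lifting]). *)

Set Implicit Arguments.
Unset Strict Implicit.
Unset Printing Implicit Defensive.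

Import GRing.Theory.
Local Open Scope ring_scope.

Local Notation "x ** y" := (amul x y) (at level 40, left associativity).

(** * Linear maps, sums of homogeneous elements, and characters of the torus *)

Section LinearFacts.
Variables (k : fieldType) (V W : lmodType k) (f : V -> W).
Hypothesis lf : linear f.
Lemma lin0 : f 0 = 0.
Proof. by have := lf (-1) 0 0; rewrite scaler0 addr0 scaleN1r addNr. Qed.
Lemma linD x y : f (x + y) = f x + f y.
Proof. by rewrite -[x]scale1r lf !scale1r. Qed.
Lemma linZ a x : f (a *: x) = a *: f x.
Proof. by rewrite -[a *: x]addr0 lf lin0 addr0. Qed.
Lemma linN x : f (- x) = - f x.
Proof. by rewrite -scaleN1r linZ scaleN1r. Qed.
Lemma linB x y : f (x - y) = f x - f y.
Proof. by rewrite linD linN. Qed.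
Lemma lin_sum (I : Type) (s : seq I) (Q : pred I) F :
  f (\sum_(i <- s | Q i) F i) = \sum_(i <- s | Q i) f (F i).
Proof. by elim/big_rec2: _ => [|i u v _ <-]; rewrite ?lin0 ?linD. Qed.
End LinearFacts.

Section Spanned.
Variables (k : fieldType) (V : lmodType k) (K : eqType) (P : K -> V -> Prop).

(** The sum of the subspaces [P i], as an inductive predicate: closure
    properties are then proved by adding one homogeneous term at a time. *)
Inductive spanned : V -> Prop :=
| spanned0 : spanned 0
| spannedD i x y : P i x -> spanned y -> spanned (x + y).

Lemma spanned1 i x : P i x -> spanned x.
Proof. by move=> Px; rewrite -[x]addr0; apply: spannedD Px spanned0. Qed.

Lemma spanned_add x y : spanned x -> spanned y -> spanned (x + y).
Proof.
elim=> [|i u v Pu _ IH] sy; first by rewrite add0r.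
by rewrite -addrA; apply: spannedD Pu (IH sy).
Qed.

Lemma spanned_sum (I : Type) (s : seq I) (Q : pred I) F :
  (forall i, Q i -> spanned (F i)) -> spanned (\sum_(i <- s | Q i) F i).
Proof.
move=> H; elim: s => [|i s IH]; first by rewrite big_nil; apply: spanned0.
by rewrite big_cons; case: ifP => // Qi; apply: spanned_add => //; apply: H.
Qed.

Hypothesis P_lin : forall i a x y, P i x -> P i y -> P i (a *: x + y).
Hypothesis P0 : forall i, P i 0.

Lemma spanned_lin a x y : spanned x -> spanned y -> spanned (a *: x + y).
Proof.
move=> + sy; elim=> [|i u v Pu _ IH]; first by rewrite scaler0 add0r.
rewrite scalerDr -addrA; apply: (spannedD (i := i)) IH.
by rewrite -[_ *: _]addr0; apply: P_lin.
Qed.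

(** Terms with the same index can be merged, so that the indices of a
    decomposition may be assumed distinct. *)
Lemma spanned_normal x : spanned x -> exists (s : seq K) (c : K -> V),
  [/\ uniq s, forall i, P i (c i) & x = \sum_(i <- s) c i].
Proof.
elim=> [|i u v Pu _ [s [c [us Pc ->]]]].
  by exists [::], (fun=> 0); rewrite big_nil.
exists (if i \in s then s else i :: s),
  (fun j => if j == i then (if i \in s then u + c i else u) else c j); split.
- by case: ifP => //= ->.
- move=> j; case: eqP => [->|_ //]; case: ifP => // _.
  by rewrite -[u]scale1r; apply: P_lin.
case: ifP => si; last first.
  rewrite big_cons eqxx; congr (_ + _).
  by apply: eq_big_seq => j js; case: eqP => // ji; rewrite -ji js in si.
rewrite (bigD1_seq i) //= [RHS](bigD1_seq i) //= eqxx addrA.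
by congr (_ + _); apply: eq_bigr => j /negbTE ->.
Qed.

End Spanned.

Lemma spanned_image (k : fieldType) (V W : lmodType k) (K L : eqType)
    (P : K -> V -> Prop) (Q : L -> W -> Prop) (f : V -> W) :
  linear f -> (forall i x, P i x -> spanned Q (f x)) ->
  forall x, spanned P x -> spanned Q (f x).
Proof.
move=> lf H x; have f0 : f 0 = 0.
  by have := lf (-1) 0 0; rewrite scaler0 addr0 scaleN1r addNr.
elim=> [|i u v Pu _ IH]; first by rewrite f0; apply: spanned0.
by rewrite -[u]scale1r lf scale1r; apply: spanned_add => //; apply: H Pu.
Qed.

Section Characters.
Variables (k : fieldType) (hk : [pchar k] =i pred0) (r : nat).
Local Notation T := (torus k r).

Definition weight := {ffun 'I_r -> int}.
Definition chi (w : weight) (t : T) : k := \prod_i t i ^ w i.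

Lemma torus_neq0 (t : T) i : t i != 0.
Proof. by have /forallP := tcoord_neq0 t. Qed.

Lemma chi0 t : chi 0 t = 1.
Proof. by apply: big1 => i _; rewrite ffunE expr0z. Qed.

Lemma chiD v w t : chi (v + w) t = chi v t * chi w t.
Proof.
rewrite -big_split; apply: eq_bigr => i _ /=.
by rewrite ffunE expfzDr // torus_neq0.
Qed.

Lemma chiM w s t : chi w (s * t)%g = chi w s * chi w t.
Proof. by rewrite -big_split; apply: eq_bigr => i _ /=; rewrite ffunE expfzMl. Qed.

Lemma chi1 w : chi w 1%g = 1.
Proof. by apply: big1 => i _; rewrite ffunE exp1rz. Qed.

Lemma chi_neq0 w t : chi w t != 0.
Proof.
by rewrite /chi prodf_seq_neq0; apply/allP => i _ /=; rewrite expfz_neq0 // torus_neq0.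
Qed.

(** In characteristic [0] the element [2] has infinite order in the
    multiplicative group; it is enough to separate characters. *)
Lemma two_exp_neq1 (m : int) : m != 0 -> (2 : k) ^ m != 1.
Proof.
move=> m0; have h (n : nat) : n != 0%N -> (2 : k) ^+ n != 1.
  move=> n0; have n1 : (1 <= 2 ^ n)%N by rewrite expn_gt0.
  rewrite -subr_eq0 -natrX -(natrB k n1) ((pcharf0P k).1 hk).
  by rewrite subn_eq0 -ltnNge -{1}(expn0 2) ltn_exp2l // lt0n.
case: m m0 => n n0; first exact: h.
by rewrite NegzE -exprnN invr_eq1; apply: h.
Qed.

Lemma chi_sep v w : v != w -> exists t, chi v t != chi w t.
Proof.
move=> vw; have [i vwi] : exists i, v i != w i.
  apply: contra_neqP vw => h; apply/ffunP => i.
  by apply/eqP/negPn/negP => vwi; apply: h; exists i.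
have two0 : (2 : k) != 0 by rewrite ((pcharf0P k).1 hk).
have tP : [forall j, [ffun j => if j == i then 2 else 1 : k] j != 0].
  by apply/forallP => j; rewrite ffunE; case: ifP => _; rewrite ?oner_neq0.
exists (Torus tP).
have E u : chi u (Torus tP) = 2 ^ u i.
  rewrite /chi (bigD1 i) //= ffunE eqxx big1 ?mulr1 // => j /negbTE ji.
  by rewrite ffunE ji exp1rz.
rewrite !E -subr_eq0.
have -> : (2 : k) ^ v i = 2 ^ (v i - w i) * 2 ^ w i by rewrite -expfzDr ?subrK.
rewrite -{2}[_ ^ w i]mul1r -mulrBl mulf_neq0 ?expfz_neq0 // subr_eq0.
by apply: two_exp_neq1; rewrite subr_eq0.
Qed.

(** Independence of characters, with vector coefficients.  If [t0] separates
    [w] from [w0], then subtracting [chi w0 t0] times the relation from its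
    translate by [t0] eliminates [w0] and multiplies the coefficient of [w] by
    a nonzero scalar. *)
Lemma chi_indep (V : lmodType k) (s : seq weight) (v : weight -> V) :
  uniq s -> (forall t, \sum_(w <- s) chi w t *: v w = 0) ->
  forall w, w \in s -> v w = 0.
Proof.
elim: s v => [//|w0 s IH] v /= /andP[w0s us] H.
have vs w : w \in s -> v w = 0.
  move=> ws; have /chi_sep [t0 ht0] : w != w0 by apply: contraNneq w0s => <-.
  have := IH (fun w => (chi w t0 - chi w0 t0) *: v w) us _ w ws.
  have Hd t : \sum_(u <- s) chi u t *: ((chi u t0 - chi w0 t0) *: v u) = 0.
    have := H (t * t0)%g; have := congr1 (fun x => chi w0 t0 *: x) (H t).
    rewrite !big_cons scaler0 scalerDr scalerA chiM [chi w0 t * _]mulrC => e1 e2.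
    have : \sum_(u <- s) chi u (t * t0)%g *: v u
        - chi w0 t0 *: \sum_(u <- s) chi u t *: v u = 0.
      apply/eqP; rewrite subr_eq0; apply/eqP.
      by apply: (addrI ((chi w0 t0 * chi w0 t) *: v w0)); rewrite e1 e2.
    move=> e3; rewrite -[RHS]e3 scaler_sumr -sumrB; apply: eq_bigr => u _.
    by rewrite !scalerA chiM -scalerBl mulrBr [chi w0 t0 * _]mulrC.
  move=> /(_ Hd) /eqP; rewrite scaler_eq0 subr_eq0 (negbTE ht0).
  by move=> /eqP.
move=> w; rewrite inE => /orP[/eqP ->|/vs //].
have := H 1%g; rewrite big_cons chi1 scale1r big_seq big1 ?addr0 // => u us'.
by rewrite vs // scaler0.
Qed.

End Characters.

(** * Graded algebras with a torus action *)

Section AlgebraFacts.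
Variables (k : fieldType) (A : algebra k).
Implicit Types x y z : A.
Lemma amul0x x : 0 ** x = 0. Proof. exact: lin0 (amulPl x). Qed.
Lemma amulx0 x : x ** 0 = 0. Proof. exact: lin0 (amulPr x). Qed.
Lemma amulDl x y z : (x + y) ** z = x ** z + y ** z.
Proof. exact: linD (amulPl z) _ _. Qed.
Lemma amulDr x y z : z ** (x + y) = z ** x + z ** y.
Proof. exact: linD (amulPr z) _ _. Qed.
Lemma amulBl x y z : (x - y) ** z = x ** z - y ** z.
Proof. exact: linB (amulPl z) _ _. Qed.
Lemma amulBr x y z : z ** (x - y) = z ** x - z ** y.
Proof. exact: linB (amulPr z) _ _. Qed.
Lemma amulNl x z : (- x) ** z = - (x ** z).
Proof. exact: linN (amulPl z) _. Qed.
Lemma amulZl a x z : (a *: x) ** z = a *: (x ** z).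
Proof. exact: linZ (amulPl z) _ _. Qed.
Lemma amulZr a x z : z ** (a *: x) = a *: (z ** x).
Proof. exact: linZ (amulPr z) _ _. Qed.
End AlgebraFacts.

Section Predga.
Variables (k : fieldType) (r : nat).
Local Notation T := (torus k r).
Local Notation weight := (weight r).

(** A [tdga] except that the algebra need not be the sum of its homogeneous
    elements nor the action rational.  Products of infinite families, the path
    algebra and the algebra of functions on the torus are of this kind; the
    subalgebra generated by bihomogeneous elements is then a genuine [tdga]. *)
Record pretdga := Pretdga {
  pcar :> algebra k;
  phomog : nat -> pcar -> Prop;
  pdiff : pcar -> pcar;
  pact : T -> pcar -> pcar;
  pdiff_lin : linear pdiff;
  phomog0 : forall n, phomog n 0;
  phomogP : forall n (a : k) x y, phomog n x -> phomog n y -> phomog n (a *: x + y);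
  phomog_direct : forall (n : nat) (c : nat -> pcar),
    (forall i, phomog i (c i)) -> \sum_(i < n) c i = 0 ->
    forall i, (i < n)%N -> c i = 0;
  phomog1 : phomog 0 (aone pcar);
  phomogM : forall i j x y, phomog i x -> phomog j y -> phomog (i + j) (x ** y);
  pdiff_homog0 : forall x, phomog 0 x -> pdiff x = 0;
  pdiff_homogS : forall n x, phomog n.+1 x -> phomog n (pdiff x);
  pdiffK : forall x, pdiff (pdiff x) = 0;
  pdiffM : forall i x y, phomog i x ->
    pdiff (x ** y) = pdiff x ** y + (-1)%R ^+ i *: (x ** pdiff y);
  pact_lin : forall t, linear (pact t);
  pact1 : forall t, pact t (aone pcar) = aone pcar;
  pactM : forall t x y, pact t (x ** y) = pact t x ** pact t y;
  pact_homog : forall t n x, phomog n x -> phomog n (pact t x);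
  pact_diff : forall t x, pact t (pdiff x) = pdiff (pact t x);
  pact_id : forall x, pact 1%g x = x;
  pact_mul : forall s t x, pact (s * t)%g x = pact s (pact t x)
}.

Definition tdga_pre (A : tdga k r) : pretdga.
Proof.
apply: (@Pretdga A (@homog _ A) (dga_diff A) (fun t => tact A t)).
- by move=> a x y; rewrite linearP.
- exact: homog0.
- exact: homogP.
- exact: homog_direct.
- exact: homog1.
- exact: homogM.
- exact: dga_diff_homog0.
- exact: dga_diff_homogS.
- exact: dga_diffK.
- exact: dga_diffM.
- by move=> t; apply: dga_funL.
- by move=> t; apply: dga_fun1.
- by move=> t; apply: dga_funM.
- by move=> t n x; apply: dga_fun_homog.
- by move=> t; apply: dga_fun_diff.
- by move=> x; rewrite tact1.
- by move=> s t x; rewrite tactM.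
Defined.
Coercion tdga_pre : tdga >-> pretdga.
Canonical tdga_pre.

(** Morphisms as a predicate on functions, so that composites and
    restrictions need no repackaging. *)
Record is_hom (X Y : pretdga) (f : X -> Y) : Prop := IsHom {
  hom_lin : linear f;
  hom1 : f (aone X) = aone Y;
  homM : forall x y, f (x ** y) = f x ** f y;
  hom_homog : forall n x, phomog n x -> phomog n (f x);
  hom_diff : forall x, f (pdiff x) = pdiff (f x);
  hom_act : forall t x, f (pact t x) = pact t (f x)
}.

Lemma is_hom_comp (X Y Z : pretdga) (g : Y -> Z) (f : X -> Y) :
  is_hom g -> is_hom f -> is_hom (g \o f).
Proof.
move=> [g1 g2 g3 g4 g5 g6] [f1 f2 f3 f4 f5 f6]; split=> /=.
- by move=> a x y /=; rewrite f1 g1.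
- by rewrite f2.
- by move=> x y; rewrite f3.
- by move=> n x /f4 /g4.
- by move=> x; rewrite f5.
- by move=> t x; rewrite f6.
Qed.

Lemma tdga_is_hom (A B : tdga k r) (f : tdga_hom A B) : @is_hom A B f.
Proof.
split.
- exact: dga_funL.
- exact: dga_fun1.
- exact: dga_funM.
- exact: dga_fun_homog.
- exact: dga_fun_diff.
- exact: tdga_funT.
Qed.

Definition hom_tdga (A B : tdga k r) (f : A -> B) (h : @is_hom A B f) : tdga_hom A B :=
  TdgaHom (tdga_fun := DgaHom (hom_lin h) (hom1 h) (homM h) (hom_homog h) (hom_diff h))
    (hom_act h).

Lemma hom_tdgaP (A B : tdga k r) (f g : tdga_hom A B) : (forall x : A, f x = g x) -> f = g.
Proof. by move=> h; apply/tdga_homP/dga_homP. Qed.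

Definition bihom (X : pretdga) (d : nat * weight) (x : X) :=
  phomog d.1 x /\ forall t, pact t x = chi d.2 t *: x.

Definition bispan (X : pretdga) (x : X) := spanned (@bihom X) x.

Section BihomFacts.
Variable X : pretdga.
Implicit Types (x y : X) (d : nat * weight).

Lemma bihom0 d : bihom d (0 : X).
Proof. by split=> [|t]; [apply: phomog0|rewrite (lin0 (pact_lin t)) scaler0]. Qed.

Lemma bihomP d a x y : bihom d x -> bihom d y -> bihom d (a *: x + y).
Proof.
move=> [hx tx] [hy ty]; split=> [|t]; first exact: phomogP.
by rewrite pact_lin tx ty scalerDr !scalerA mulrC.
Qed.

Lemma bihomZ d a x : bihom d x -> bihom d (a *: x).
Proof. by move=> h; rewrite -[_ *: _]addr0; apply: bihomP (bihom0 d). Qed.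

Lemma bihomD d x y : bihom d x -> bihom d y -> bihom d (x + y).
Proof. by move=> h; rewrite -[x]scale1r; apply: bihomP. Qed.

Lemma bihom1 : bihom (0%N, 0) (aone X).
Proof. by split=> [|t]; [apply: phomog1|rewrite pact1 chi0 scale1r]. Qed.

Lemma bihomM d e x y : bihom d x -> bihom e y ->
  bihom ((d.1 + e.1)%N, d.2 + e.2) (x ** y).
Proof.
move=> [hx tx] [hy ty]; split=> [|t]; first exact: phomogM.
by rewrite pactM tx ty amulZl amulZr scalerA chiD.
Qed.

Lemma bihom_diff n w x : bihom (n.+1, w) x -> bihom (n, w) (pdiff x).
Proof.
move=> [hx tx]; split=> [|t]; first exact: pdiff_homogS.
by rewrite pact_diff tx (linZ (@pdiff_lin X)).
Qed.

Lemma bihom_diff0 w x : bihom (0%N, w) x -> pdiff x = 0.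
Proof. by move=> [hx _]; apply: pdiff_homog0. Qed.

Lemma bihom_act d s x : bihom d x -> bihom d (pact s x).
Proof. by move=> h; rewrite h.2; apply: bihomZ. Qed.

Lemma bispan_lin a x y : bispan x -> bispan y -> bispan (a *: x + y).
Proof. by apply: spanned_lin bihom0 _ _ _; apply: bihomP. Qed.

Lemma bispanM x y : bispan x -> bispan y -> bispan (x ** y).
Proof.
move=> + sy; elim=> [|d u v hu _ IH]; first by rewrite amul0x; apply: spanned0.
rewrite amulDl; apply: spanned_add IH.
elim: sy => [|e u' v' hu' _ IH]; first by rewrite amulx0; apply: spanned0.
by rewrite amulDr; apply: (spannedD (bihomM hu hu')).
Qed.

Lemma bispan_diff x : bispan x -> bispan (pdiff x).
Proof.
apply: (spanned_image (@pdiff_lin X)) => -[[|n] w] {}x hx.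
  by rewrite (bihom_diff0 hx); apply: spanned0.
by apply: spanned1 (bihom_diff hx).
Qed.

Lemma bispan_act t x : bispan x -> bispan (pact t x).
Proof.
apply: (spanned_image (@pact_lin X t)) => d {}x hx.
by apply: spanned1 (bihom_act t hx).
Qed.

End BihomFacts.

Lemma is_hom_bihom (X Y : pretdga) (f : X -> Y) d x :
  is_hom f -> bihom d x -> bihom d (f x).
Proof.
move=> hf [hx tx]; split; first exact: hom_homog.
by move=> t; rewrite -(hom_act hf) tx (linZ (hom_lin hf)).
Qed.

Section BihomDirect.
Hypothesis hk : [pchar k] =i pred0.

(** For fixed degree, acting by [t] turns a vanishing sum of weight vectors
    into a relation between characters. *)
Lemma bihom_direct (X : pretdga) (s : seq (nat * weight)) (c : nat * weight -> X) :
  uniq s -> (forall d, bihom d (c d)) -> \sum_(d <- s) c d = 0 ->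
  forall d, d \in s -> c d = 0.
Proof.
move=> us hc H [n w] ds.
have Hn : \sum_(d <- s | d.1 == n) c d = 0.
  pose C i := \sum_(d <- s | d.1 == i) c d.
  have hC i : phomog i (C i).
    apply: (big_ind (@phomog X i)) => [|x y hx hy|[m v] /= /eqP <-].
    - exact: phomog0.
    - by rewrite -[x]scale1r; apply: phomogP.
    - by have [] := hc (m, v).
  pose N := (\max_(d <- s) d.1).+1.
  have ltN d : d \in s -> (d.1 < N)%N.
    by move=> hd; rewrite ltnS; apply: (@leq_bigmax_seq _ s predT (fun d => d.1) d).
  have CS : \sum_(i < N) C i = 0.
    rewrite -[RHS]H /C (exchange_big_dep predT) //= big_seq [RHS]big_seq.
    apply: eq_bigr => d /ltN dN; rewrite (big_pred1 (Ordinal dN)) //.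
  exact: (phomog_direct hC CS (ltN _ ds)).
pose s' := [seq d.2 | d <- s & d.1 == n].
have us' : uniq s'.
  rewrite map_inj_in_uniq ?filter_uniq // => -[a b] [a' b'].
  by rewrite !mem_filter /= => /andP[/eqP -> _] /andP[/eqP -> _] ->.
apply: (chi_indep hk (V := X) (v := fun v => c (n, v)) us' _ (w := w)); last first.
  by apply/mapP; exists (n, w); rewrite // mem_filter eqxx.
move=> t; have := congr1 (pact t) Hn.
rewrite (lin0 (pact_lin t)) (lin_sum (pact_lin t)) big_map big_filter => E.
rewrite -[RHS]E.
by apply: eq_bigr => -[m v] /= /eqP ->; have [_ ->] := hc (n, v).
Qed.

Section Extension.
Variables (A : pretdga) (V : lmodType k) (g : nat * weight -> A -> V).
Hypothesis spanA : forall x : A, bispan x.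
Hypothesis g_lin : forall d, linear (g d).

(** A linear map out of an algebra spanned by bihomogeneous elements may be
    prescribed in each bidegree.  Its graph is the span of the pairs
    [(x, g d x)]; the directness of the decomposition makes the graph functional. *)
Lemma bihom_extension :
  exists G : A -> V, linear G /\ forall d x, bihom d x -> G x = g d x.
Proof.
pose P (d : nat * weight) (p : A * V) := bihom d p.1 /\ p.2 = g d p.1.
have P0 d : P d 0 by split; [apply: bihom0|rewrite /= (lin0 (g_lin d))].
have PP d a p q : P d p -> P d q -> P d (a *: p + q).
  by move=> [h1 h2] [h3 h4]; split; [apply: bihomP|rewrite /= g_lin h2 h4].
pose R x v := spanned P (x, v).
have R0 v : R 0 v -> v = 0.
  case/(spanned_normal PP P0) => s [c [us Pc Ec]].
  have E1 : \sum_(i <- s) (c i).1 = 0.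
    by have /(congr1 fst) /= := Ec; rewrite raddf_sum.
  have -> : v = \sum_(i <- s) (c i).2.
    by have /(congr1 snd) /= := Ec; rewrite raddf_sum.
  rewrite big_seq big1 // => i si; have [h ->] := Pc i.
  have := bihom_direct (c := fun i => (c i).1) us (fun i => (Pc i).1) E1 si.
  by move=> ->; apply: lin0.
have RP a x y v w : R x v -> R y w -> R (a *: x + y) (a *: v + w).
  exact: (spanned_lin PP).
have Rex x : exists v, R x v.
  elim: (spanA x) => [|d u v hu _ [w Rw]]; first by exists 0; apply: spanned0.
  exists (g d u + w); apply: (@spannedD _ _ _ _ d (u, g d u) (v, w)) Rw.
  by split.
have Run x v w : R x v -> R x w -> v = w.
  move=> Rv Rw; apply/eqP; rewrite -subr_eq0; apply/eqP/R0.
  by have := RP (-1) x x w v Rw Rv; rewrite !scaleN1r addNr addrC.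
exists (fun x => projT1 (cid (Rex x))); split.
  move=> a x y; case: cid => u Ru; case: cid => v Rv; case: cid => w Rw /=.
  by apply: Run Ru _; apply: RP.
move=> d x hx; case: cid => v Rv /=; apply: Run Rv _; apply: (@spanned1 _ _ _ _ d).
by split.
Qed.

End Extension.

Lemma lin_bispan_eq (A : pretdga) (V : lmodType k) (f g : A -> V) :
  linear f -> linear g -> (forall d x, bihom d x -> f x = g x) ->
  forall x, bispan x -> f x = g x.
Proof.
move=> lf lg h x; elim=> [|d u v hu _ IH]; first by rewrite (lin0 lf) (lin0 lg).
by rewrite (linD lf) (linD lg) (h _ _ hu) IH.
Qed.

End BihomDirect.
End Predga.

(** * Rational actions are weight gradings *)

Section TdgaSpan.
Variables (k : fieldType) (hk : [pchar k] =i pred0) (r : nat).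
Local Notation T := (torus k r).
Local Notation weight := (weight r).

(** The function [t |-> act t a] is a finite combination of characters with
    coefficients in [V]; comparing its values at [s * t] with the action of [s]
    on its value at [t], independence of characters shows that the coefficient
    of [chi w] is a vector of weight [w].  They add up to [act 1 a = a]. *)
Lemma rational_weight_span (V : lmodType k) (act : T -> V -> V) (a : V) :
  rational_action act -> (forall t, linear (act t)) ->
  act 1%g a = a -> (forall s t x, act (s * t)%g x = act s (act t x)) ->
  spanned (fun w v => forall t, act t v = chi w t *: v) a.
Proof.
move=> /(_ a) [m [e [rho [_ [c Ea] he _ hrho]]]] lact act1 actM.
pose P w (F : T -> V) := forall t, F t = chi w t *: F 1%g.
have PP w b (F G : T -> V) : P w F -> P w G -> P w (b *: F + G).
  move=> hF hG t; rewrite !addrfctE !scalrfctE hF hG.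
  by rewrite scalerDr !scalerA mulrC.
have P0 w : P w 0 by move=> t; rewrite scaler0.
have : spanned P (fun t => act t a).
  have -> : (fun t => act t a) =
      \sum_j \sum_i (fun t => (c j * rho t i j) *: e i).
    apply/funext => t; rewrite fct_sumE Ea (lin_sum (lact t)).
    apply: eq_bigr => j _; rewrite (linZ (lact t)) he fct_sumE scaler_sumr.
    by apply: eq_bigr => i _; rewrite scalerA.
  apply: spanned_sum => j _; apply: spanned_sum => i _.
  have [s hs] := hrho i j.
  have -> : (fun t => (c j * rho t i j) *: e i) =
      \sum_(p <- s) (fun t => chi p.2 t *: ((c j * p.1) *: e i)).
    apply/funext => t; rewrite fct_sumE hs mulr_sumr scaler_suml.
    by apply: eq_bigr => p _; rewrite scalerA [chi _ _ * _]mulrC mulrA.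
  apply: spanned_sum => p _; apply: (@spanned1 _ _ _ _ p.2) => t.
  by rewrite chi1 scale1r.
case/(spanned_normal PP P0) => s [F [us hF EF]].
have Et t : act t a = \sum_(w <- s) chi w t *: F w 1%g.
  have := congr1 (fun f => f t) EF; rewrite fct_sumE => ->.
  by apply: eq_bigr => w _; rewrite hF.
have hv w : w \in s -> forall t, act t (F w 1%g) = chi w t *: F w 1%g.
  move=> ws t; apply/eqP; rewrite -subr_eq0; apply/eqP.
  apply: (chi_indep hk us _ ws (v := fun w => act t (F w 1%g) - chi w t *: F w 1%g)).
  move=> t'; have := actM t t' a; rewrite !Et (lin_sum (lact t)) => /esym E.
  rewrite (_ : \sum_(u <- s) _ = \sum_(u <- s) act t (chi u t' *: F u 1%g)
     - \sum_(u <- s) chi u (t * t')%g *: F u 1%g); first by rewrite E subrr.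
  rewrite -sumrB; apply: eq_bigr => u _.
  by rewrite scalerBr (linZ (lact t)) scalerA chiM [chi u t * _]mulrC.
rewrite -act1 Et big_seq; apply: spanned_sum => w ws.
by apply: (@spanned1 _ _ _ _ w) => t; rewrite chi1 scale1r hv.
Qed.

(** The homogeneous components of a weight vector are weight vectors, as the
    action preserves degrees. *)
Lemma tdga_bispan (A : tdga k r) (x : A) : bispan (X := A) x.
Proof.
have : spanned (fun w (v : A) => forall t, tact A t v = chi w t *: v) x.
  apply: rational_weight_span; first exact: tact_rational.
  - by move=> t; apply: dga_funL.
  - by rewrite tact1.
  - by move=> s t y; rewrite tactM.
elim=> [|w u v hu _ IH]; first exact: spanned0.
apply: spanned_add IH; have [n [c [hc Eu]]] := homog_span u.
rewrite {}Eu in hu *; rewrite -(big_mkord predT c) big_nat.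
apply: spanned_sum => i /andP[_ iltn]; apply: (@spanned1 _ _ _ _ (i, w)).
split=> [|t]; first exact: hc.
apply/eqP; rewrite -subr_eq0; apply/eqP.
pose C i := tact A t (c i) - chi w t *: c i.
apply: (homog_direct (c := C) _ _ iltn) => [j|].
  rewrite /C addrC -scaleNr; apply: homogP; first exact: hc.
  by apply: dga_fun_homog; apply: hc.
by rewrite sumrB -scaler_sumr -hu (lin_sum (@dga_funL _ _ _ (tact A t))) subrr.
Qed.

Lemma chi_indep_ord (V : lmodType k) m (d : 'I_m -> weight) (v : 'I_m -> V) :
  injective d -> (forall t, \sum_i chi (d i) t *: v i = 0) -> forall i, v i = 0.
Proof.
move=> inj H i; pose v' w := if [pick i | d i == w] is Some j then v j else 0.
have v'E j : v' (d j) = v j.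
  by rewrite /v'; case: pickP => [l /eqP /inj -> //|/(_ j)]; rewrite eqxx.
rewrite -v'E; apply: (chi_indep hk (s := [seq d i | i <- enum 'I_m])).
- by rewrite map_inj_uniq ?enum_uniq //.
- move=> t; rewrite -[RHS](H t) big_map big_enum /=.
  by apply: eq_bigr => j _; rewrite v'E.
- by rewrite mem_map // mem_enum.
Qed.

(** The nonzero weight components of [a] are independent and span a stable
    subspace containing [a], on which the action is diagonal. *)
Lemma weight_span_rational (V : lmodType k) (act : T -> V -> V) :
  (forall t, linear (act t)) ->
  (forall a, spanned (fun w v => forall t, act t v = chi w t *: v) a) ->
  rational_action act.
Proof.
move=> lact H a.
have P0 w t : act t 0 = chi w t *: 0 by rewrite scaler0 (lin0 (lact t)).
have PP w b u v : (forall t, act t u = chi w t *: u) ->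
    (forall t, act t v = chi w t *: v) ->
    forall t, act t (b *: u + v) = chi w t *: (b *: u + v).
  by move=> hu hv t; rewrite lact hu hv scalerDr !scalerA mulrC.
have [s [c [us hc Ea]]] := spanned_normal PP P0 (H a).
pose s' := [seq w <- s | c w != 0]; pose d := tnth (in_tuple s').
have us' : uniq s' by rewrite filter_uniq.
have injd : injective d by apply/tuple_uniqP.
have cd i : c (d i) != 0.
  by have := mem_tnth i (in_tuple s'); rewrite mem_filter => /andP[].
exists (size s'), (fun i => c (d i)), (fun t => diag_mx (\row_i chi (d i) t)).
split.
- move=> b Eb i; apply/eqP; have := cd i; apply: contraNT => bi.
  have : b i *: c (d i) = 0.
    apply: (chi_indep_ord injd (v := fun i => b i *: c (d i))) => t.
    rewrite -[RHS](lin0 (lact t)) -[in RHS]Eb (lin_sum (lact t)).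
    by apply: eq_bigr => j _; rewrite (linZ (lact t)) hc !scalerA mulrC.
  by move/eqP; rewrite scaler_eq0 (negbTE bi).
- exists (fun=> 1); have -> : a = \sum_(w <- s | c w != 0) c w.
    by rewrite Ea [RHS]big_mkcond; apply: eq_bigr => w _; case: eqP.
  rewrite -big_filter big_tnth.
  by apply: eq_bigr => i _; rewrite scale1r.
- move=> t j; rewrite (bigD1 j) //= big1 ?addr0.
    by rewrite !mxE eqxx hc.
  by move=> i /negbTE ij; rewrite !mxE ij scale0r.
- move=> t; rewrite unitmxE det_diag unitfE; apply/prodf_neq0 => i _.
  by rewrite mxE chi_neq0.
- move=> i j; exists [:: ((i == j)%:R, d i)] => t.
  by rewrite big_seq1 !mxE /= mulr_natl; case: eqP => // ->.
Qed.

Section FromPre.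
Variables (X : pretdga k r) (spanX : forall x : X, bispan x).

Lemma pre_homog_span (x : X) : exists (n : nat) (c : nat -> X),
    (forall i, phomog i (c i)) /\ x = \sum_(i < n) c i.
Proof.
have : spanned (@phomog _ _ X) x.
  apply: (spanned_image (f := id)) (spanX x) => // d y hy.
  exact: spanned1 hy.1.
case/(spanned_normal (@phomogP _ _ X) (@phomog0 _ _ X)) => s [c [us hc ->]].
exists (\max_(i <- s) i).+1, (fun i => if i \in s then c i else 0); split.
  by move=> i; case: ifP => // _; apply: phomog0.
rewrite -(big_mkord predT (fun i => if i \in s then c i else 0)) -big_mkcond.
rewrite -[RHS]big_filter; apply: perm_big; apply: uniq_perm => //.
  by rewrite filter_uniq ?iota_uniq.
move=> i; rewrite mem_filter mem_index_iota /=; case: (boolP (i \in s)) => //= si.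
by rewrite ltnS (@leq_bigmax_seq _ s predT id).
Qed.

HB.instance Definition _ := GRing.isLinear.Build k X X _ (@pdiff _ _ X) (@pdiff_lin _ _ X).

Definition pre_dga : dga k :=
  @Dga k X (@phomog _ _ X) (@pdiff _ _ X) (@phomog0 _ _ X) (@phomogP _ _ X)
    pre_homog_span (@phomog_direct _ _ X) (@phomog1 _ _ X) (@phomogM _ _ X)
    (@pdiff_homog0 _ _ X) (@pdiff_homogS _ _ X) (@pdiffK _ _ X) (@pdiffM _ _ X).

Definition pre_act (t : T) : dga_hom pre_dga pre_dga :=
  @DgaHom _ pre_dga pre_dga (pact t) (@pact_lin _ _ X t) (pact1 X t)
   (@pactM _ _ X t) (@pact_homog _ _ X t) (@pact_diff _ _ X t).

Definition pre_tdga : tdga k r.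
Proof.
apply: (@Tdga k r pre_dga pre_act).
- by apply: dga_homP => x /=; apply: pact_id.
- by move=> s t; apply: dga_homP => x /=; apply: pact_mul.
- apply: weight_span_rational; first by move=> t; apply: pact_lin.
  move=> x; apply: (spanned_image (f := id)) (spanX x) => // d y hy.
  exact: spanned1 hy.2.
Defined.

End FromPre.
End TdgaSpan.

(** * The algebra generated by a family of operations *)

Section GeneratedDef.
Variables (k : fieldType) (r : nat).
Variables (U : Type) (deg : U -> nat * weight r).
Variables (I : Type) (X : I -> pretdga k r) (o : forall i, U -> X i -> X i).
Variables (Z : tdga k r) (oZ : U -> Z -> Z) (pi : forall i, Z -> X i).

(** [Z] is the subalgebra of the product of the [X i] generated by the
    operations [o]: it embeds by the maps [pi i], with the induced grading, and
    maps out of it are determined by their compatibility with the operations.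
    Constants are operations that ignore their argument. *)
Record is_generated : Prop := IsGenerated {
  gen_hom : forall i, is_hom (pi i);
  gen_deg : forall u z, bihom (X := Z) (deg u) (oZ u z);
  gen_op : forall i u z, pi i (oZ u z) = o u (pi i z);
  gen_inj : forall z z', (forall i, pi i z = pi i z') -> z = z';
  gen_homog : forall n z, (forall i, phomog n (pi i z)) -> phomog (p := Z) n z;
  gen_ext : forall (Y : pretdga k r) (f g : Z -> Y), is_hom f -> is_hom g ->
    (forall u z, f z = g z -> f (oZ u z) = g (oZ u z)) -> f =1 g
}.

End GeneratedDef.

Section Generated.
Variables (k : fieldType) (hk : [pchar k] =i pred0) (r : nat).
Local Notation T := (torus k r).
Local Notation weight := (weight r).
Variables (U : Type) (deg : U -> nat * weight).
Variables (I : Type) (X : I -> pretdga k r) (o : forall i, U -> X i -> X i).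
Hypothesis ho : forall i u x, bihom (deg u) (@o i u x).

(** Formal expressions for the elements of the generated algebra. *)
Inductive term : Type :=
| t_one
| t_lin of k & term & term
| t_mul of term & term
| t_diff of term
| t_act of T & term
| t_op of U & term.

Fixpoint eval i (t : term) : X i :=
  match t with
  | t_one => aone (X i)
  | t_lin a s t => a *: eval i s + eval i t
  | t_mul s t => eval i s ** eval i t
  | t_diff t => pdiff (eval i t)
  | t_act s t => pact s (eval i t)
  | t_op u t => o u (eval i t)
  end.

Definition agree (s t : term) : Prop := forall i, eval i s = eval i t.

(** Classes of terms, as predicates on terms.  The class is small even when [I]
    is a proper class, since the quantification over [I] in [agree] happens in
    [Prop]. *)
Definition gen_type : Type := {c : term -> Prop | exists t, c = agree t}.
HB.instance Definition _ := gen_eqMixin gen_type.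
HB.instance Definition _ := gen_choiceMixin gen_type.

Definition gen_class (t : term) : gen_type := exist _ (agree t) (ex_intro _ t erefl).
Definition gen_repr (z : gen_type) : term := projT1 (cid (proj2_sig z)).
Definition gen_proj i (z : gen_type) : X i := eval i (gen_repr z).

Lemma gen_proj_class i t : gen_proj i (gen_class t) = eval i t.
Proof.
rewrite /gen_proj /gen_repr; case: cid => s /= E.
by have : agree s s by []; rewrite -E => /(_ i).
Qed.

(** This reduces every identity to be proved in the generated algebra to
    the same identity in each [X i]. *)
Lemma gen_proj_inj (z z' : gen_type) : (forall i, gen_proj i z = gen_proj i z') -> z = z'.
Proof.
move=> H; apply: eq_sig_hprop => [? ? ?|]; first exact: Prop_irrelevance.
rewrite (projT2 (cid (proj2_sig z))).
rewrite (projT2 (cid (proj2_sig z'))) -/(gen_repr z) -/(gen_repr z').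
by apply/funext => t; apply/propext; split=> h i; rewrite -h; [symmetry|]; apply: H.
Qed.

Definition gen_lin a (y z : gen_type) := gen_class (t_lin a (gen_repr y) (gen_repr z)).
Definition gen_one := gen_class t_one.
Definition gen_zero := gen_lin (-1) gen_one gen_one.
Definition gen_mul (y z : gen_type) := gen_class (t_mul (gen_repr y) (gen_repr z)).
Definition gen_diff (z : gen_type) := gen_class (t_diff (gen_repr z)).
Definition gen_act s (z : gen_type) := gen_class (t_act s (gen_repr z)).
Definition gen_opr u (z : gen_type) := gen_class (t_op u (gen_repr z)).

Lemma gen_proj_lin i a y z : gen_proj i (gen_lin a y z) = a *: gen_proj i y + gen_proj i z.
Proof. exact: gen_proj_class. Qed.
Lemma gen_proj0 i : gen_proj i gen_zero = 0.
Proof. by rewrite gen_proj_lin scaleN1r addNr. Qed.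

Let genE := (gen_proj0, gen_proj_lin, scale1r, scaleN1r, scaler0, addr0,
  scalerDr, scalerDl, scalerA).

Definition gen_add := gen_lin 1.
Definition gen_opp z := gen_lin (-1) z gen_zero.
Definition gen_scale a z := gen_lin a z gen_zero.

Lemma gen_addA : associative gen_add.
Proof. by move=> x y z; apply: gen_proj_inj => i; rewrite !genE addrA. Qed.
Lemma gen_addC : commutative gen_add.
Proof. by move=> x y; apply: gen_proj_inj => i; rewrite !genE addrC. Qed.
Lemma gen_add0 : left_id gen_zero gen_add.
Proof. by move=> x; apply: gen_proj_inj => i; rewrite !genE add0r. Qed.
Lemma gen_addN : left_inverse gen_zero gen_opp gen_add.
Proof. by move=> x; apply: gen_proj_inj => i; rewrite !genE addNr. Qed.
HB.instance Definition _ :=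
  GRing.isZmodule.Build gen_type gen_addA gen_addC gen_add0 gen_addN.

Lemma gen_scaleA a b x : gen_scale a (gen_scale b x) = gen_scale (a * b) x.
Proof. by apply: gen_proj_inj => i; rewrite !genE. Qed.
Lemma gen_scale1 : left_id 1 gen_scale.
Proof. by move=> x; apply: gen_proj_inj => i; rewrite !genE. Qed.
Lemma gen_scaleDr : right_distributive gen_scale +%R.
Proof. by move=> a x y; apply: gen_proj_inj => i; rewrite !genE. Qed.
Lemma gen_scaleDl x : {morph gen_scale^~ x : a b / a + b}.
Proof. by move=> a b; apply: gen_proj_inj => i; rewrite !genE. Qed.
HB.instance Definition _ := GRing.Zmodule_isLmodule.Build k gen_type
  gen_scaleA gen_scale1 gen_scaleDr gen_scaleDl.

Lemma gen_projP i : linear (gen_proj i).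
Proof. by move=> a x y; rewrite !genE. Qed.
Lemma gen_proj1 i : gen_proj i gen_one = aone (X i). Proof. exact: gen_proj_class. Qed.
Lemma gen_projM i y z : gen_proj i (gen_mul y z) = gen_proj i y ** gen_proj i z.
Proof. exact: gen_proj_class. Qed.
Lemma gen_proj_diff i z : gen_proj i (gen_diff z) = pdiff (gen_proj i z).
Proof. exact: gen_proj_class. Qed.
Lemma gen_proj_act i s z : gen_proj i (gen_act s z) = pact s (gen_proj i z).
Proof. exact: gen_proj_class. Qed.
Lemma gen_proj_opr i u z : gen_proj i (gen_opr u z) = o u (gen_proj i z).
Proof. exact: gen_proj_class. Qed.

Let gen_projE := (gen_projP, gen_proj1, gen_projM, gen_proj_diff, gen_proj_act).

Definition gen_algebra : algebra k.
Proof.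
apply: (@Algebra k gen_type gen_mul gen_one).
- by move=> x y z; apply: gen_proj_inj => i; rewrite !gen_projE amulA.
- by move=> x; apply: gen_proj_inj => i; rewrite !gen_projE amul1x.
- by move=> x; apply: gen_proj_inj => i; rewrite !gen_projE amulx1.
- by move=> z a x y; apply: gen_proj_inj => i; rewrite !gen_projE amulPl.
- by move=> z a x y; apply: gen_proj_inj => i; rewrite !gen_projE amulPr.
Defined.

Definition gen_pre : pretdga k r.
Proof.
apply: (@Pretdga k r gen_algebra (fun n z => forall i, phomog n (gen_proj i z))
  gen_diff gen_act).
- by move=> a x y; apply: gen_proj_inj => i; rewrite !gen_projE pdiff_lin.
- by move=> n i; rewrite (lin0 (@gen_projP i)); apply: phomog0.
- by move=> n a x y hx hy i; rewrite gen_projP; apply: phomogP.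
- move=> n c hc H j jn; apply: gen_proj_inj => i; rewrite (lin0 (@gen_projP i)).
  apply: (phomog_direct (c := fun j => gen_proj i (c j)) _ _ jn) => [l|]; first exact: hc.
  by rewrite -(lin_sum (@gen_projP i)) H (lin0 (@gen_projP i)).
- by move=> i; rewrite !gen_projE; apply: phomog1.
- by move=> m n x y hx hy i; rewrite !gen_projE; apply: phomogM.
- move=> x hx; apply: gen_proj_inj => i.
  by rewrite !gen_projE pdiff_homog0 // (lin0 (@gen_projP i)).
- by move=> n x hx i; rewrite !gen_projE; apply: pdiff_homogS.
- by move=> x; apply: gen_proj_inj => i; rewrite !gen_projE pdiffK (lin0 (@gen_projP i)).
- move=> m x y hx; apply: gen_proj_inj => i; rewrite !gen_projE (linD (@gen_projP i)).
  by rewrite (linZ (@gen_projP i)) !gen_projE (pdiffM _ (hx i)).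
- by move=> t a x y; apply: gen_proj_inj => i; rewrite !gen_projE pact_lin.
- by move=> t; apply: gen_proj_inj => i; rewrite !gen_projE pact1.
- by move=> t x y; apply: gen_proj_inj => i; rewrite !gen_projE pactM.
- by move=> t n x hx i; rewrite !gen_projE; apply: pact_homog.
- by move=> t x; apply: gen_proj_inj => i; rewrite !gen_projE pact_diff.
- by move=> x; apply: gen_proj_inj => i; rewrite !gen_projE pact_id.
- by move=> s t x; apply: gen_proj_inj => i; rewrite !gen_projE pact_mul.
Defined.

Lemma gen_proj_hom i : @is_hom k r gen_pre (X i) (gen_proj i).
Proof.
split; [exact: gen_projP|exact: gen_proj1|exact: gen_projM| |exact: gen_proj_diff|exact: gen_proj_act].
by move=> n x; apply.
Qed.

Lemma gen_deg_opr u z : @bihom k r gen_pre (deg u) (gen_opr u z).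
Proof.
split=> [i|t]; first by rewrite gen_proj_opr; have [] := ho u (gen_proj i z).
apply: gen_proj_inj => i; rewrite (hom_act (@gen_proj_hom i)) (linZ (@gen_projP i)) gen_proj_opr.
by have [_ ->] := ho u (gen_proj i z).
Qed.

Lemma gen_classK z : gen_class (gen_repr z) = z.
Proof. by apply: gen_proj_inj => i; rewrite gen_proj_class. Qed.

Lemma gen_term_ind (P : gen_type -> Prop) :
  P gen_one -> (forall a x y, P x -> P y -> P (gen_lin a x y)) ->
  (forall x y, P x -> P y -> P (gen_mul x y)) ->
  (forall x, P x -> P (gen_diff x)) -> (forall s x, P x -> P (gen_act s x)) ->
  (forall u x, P x -> P (gen_opr u x)) -> forall z, P z.
Proof.
move=> P1 Plin Pmul Pd Pa Pu z; rewrite -(gen_classK z).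
elim: (gen_repr z) => [|a s Ps t Pt|s Ps t Pt|t Pt|s t Pt|u t Pt] //.
- have -> : gen_class (t_lin a s t) = gen_lin a (gen_class s) (gen_class t); last exact: Plin.
  by apply: gen_proj_inj => i; rewrite gen_proj_lin !gen_proj_class.
- have -> : gen_class (t_mul s t) = gen_mul (gen_class s) (gen_class t); last exact: Pmul.
  by apply: gen_proj_inj => i; rewrite gen_projM !gen_proj_class.
- have -> : gen_class (t_diff t) = gen_diff (gen_class t); last exact: Pd.
  by apply: gen_proj_inj => i; rewrite gen_proj_diff !gen_proj_class.
- have -> : gen_class (t_act s t) = gen_act s (gen_class t); last exact: Pa.
  by apply: gen_proj_inj => i; rewrite gen_proj_act !gen_proj_class.
- have -> : gen_class (t_op u t) = gen_opr u (gen_class t); last exact: Pu.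
  by apply: gen_proj_inj => i; rewrite gen_proj_opr !gen_proj_class.
Qed.

Lemma gen_linE a x y : gen_lin a x y = a *: (x : gen_type) + y.
Proof. by apply: gen_proj_inj => i; rewrite !genE. Qed.

(** Bihomogeneous sums are stable under all the algebra operations, and the
    values of the given operations are bihomogeneous; the bidegree of [o u x]
    depends on [u] only, so it is the same in all the [X i]. *)
Lemma gen_bispan (z : gen_pre) : bispan z.
Proof.
elim/gen_term_ind: z => [|a x y hx hy|x y hx hy|x hx|s x hx|u x hx].
- exact: spanned1 (bihom1 gen_pre).
- by rewrite gen_linE; apply: (@bispan_lin k r gen_pre).
- exact: (@bispanM k r gen_pre).
- exact: (@bispan_diff k r gen_pre).
- exact: (@bispan_act k r gen_pre).
- by apply: spanned1 (gen_deg_opr u x).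
Qed.

Lemma generated_exists : exists Z oZ pi, @is_generated k r U deg I X o Z oZ pi.
Proof.
exists (pre_tdga hk gen_bispan), gen_opr, gen_proj; split.
- by move=> i; case: (@gen_proj_hom i).
- by move=> u z; case: (gen_deg_opr u z).
- by move=> i u z; apply: gen_proj_opr.
- exact: gen_proj_inj.
- by [].
- move=> Y f g [f1 f2 f3 f4 f5 f6] [g1 g2 g3 g4 g5 g6] H.
  elim/gen_term_ind => [|a x y hx hy|x y hx hy|x hx|s x hx|u x /H //].
  + by rewrite [f _]f2 [g _]g2.
  + by rewrite gen_linE [f _]f1 [g _]g1 hx hy.
  + by rewrite [f _]f3 [g _]g3 hx hy.
  + by rewrite [f _]f5 [g _]g5 hx.
  + by rewrite [f _]f6 [g _]g6 hx.
Qed.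

End Generated.

(** * Limits, initial models and colimits *)

Section LimitsAndModels.
Variables (k : fieldType) (hk : [pchar k] =i pred0) (r : nat).
Local Notation weight := (weight r).

(** A family of maps [F i] factors through the generated algebra as soon as it
    does so on bihomogeneous elements, since the [pi i] are jointly injective. *)
Lemma gen_factor U deg I (X : I -> pretdga k r) o Z oZ pi (Y : tdga k r) (F : forall i, Y -> X i) :
  @is_generated k r U deg I X o Z oZ pi -> (forall i, is_hom (F i)) ->
  (forall d y, bihom (X := Y) d y -> exists z, forall i, pi i z = F i y) ->
  exists h : tdga_hom Y Z, forall i y, pi i (h y) = F i y.
Proof.
move=> G hF H.
have ex y : exists z, forall i, pi i z = F i y.
  elim: (tdga_bispan hk y) => [|d u v /H [z hz] _ [z' hz']].
    by exists 0 => i; rewrite (lin0 (hom_lin (gen_hom G i))) (lin0 (hom_lin (hF i))).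
  exists (z + z') => i; rewrite (linD (hom_lin (gen_hom G i))).
  by rewrite (linD (hom_lin (hF i))) hz hz'.
pose h y := projT1 (cid (ex y)).
have hE i y : pi i (h y) = F i y by rewrite /h; case: cid.
suff hh : is_hom h by exists (hom_tdga hh).
have pH i := gen_hom G i.
split.
- move=> a x y; apply: (gen_inj G) => i.
  by rewrite hE (hom_lin (hF i)) (hom_lin (pH i)) !hE.
- by apply: (gen_inj G) => i; rewrite hE (hom1 (hF i)) (hom1 (pH i)).
- by move=> x y; apply: (gen_inj G) => i; rewrite hE (homM (hF i)) (homM (pH i)) !hE.
- by move=> n x hx; apply: (gen_homog G) => i; rewrite hE; apply: hom_homog.
- by move=> x; apply: (gen_inj G) => i; rewrite hE (hom_diff (hF i)) (hom_diff (pH i)) hE.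
- by move=> t x; apply: (gen_inj G) => i; rewrite hE (hom_act (hF i)) (hom_act (pH i)) hE.
Qed.

Section FamilyLimit.
Variables (V : Type) (D : V -> tdga k r) (C : (forall i, D i) -> Prop).

(** Universal property of the subalgebra of the product of the [D i] formed
    by the finite sums of bihomogeneous families satisfying [C].  By
    [flim_ext], an equation between two maps out of it holds everywhere once it
    follows from [C]; cone conditions are of this form. *)
Record is_family_limit (L : tdga k r) (p : forall i, tdga_hom L (D i)) : Prop :=
  IsFamilyLimit {
  flim_inj : forall x y : L, (forall i, p i x = p i y) -> x = y;
  flim_elt : forall d (x : forall i, D i), (forall i, bihom (X := D i) d (x i)) -> C x ->
    exists2 l : L, bihom (X := L) d l & forall i, p i l = x i;
  flim_ext : forall (Y : pretdga k r) (f g : L -> Y), is_hom f -> is_hom g ->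
    (forall l, C (fun i => p i l) -> f l = g l) -> f =1 g;
  flim_map : forall (Y : tdga k r) (q : forall i, tdga_hom Y (D i)),
    (forall y, C (fun i => q i y)) ->
    exists h : tdga_hom Y L, forall i y, p i (h y) = q i y
}.

Lemma family_limit_exists : exists L p, @is_family_limit L p.
Proof.
pose U := {dx : (nat * weight) * (forall i, D i) |
  (forall i, bihom (X := D i) dx.1 (dx.2 i)) /\ C dx.2}.
pose deg (u : U) := (sval u).1.
pose o i (u : U) (_ : D i) : D i := (sval u).2 i.
have ho i u x : bihom (X := D i) (deg u) (@o i u x).
  exact: (svalP u).1.
have [L [oL [pi G]]] := generated_exists hk ho.
exists L, (fun i => hom_tdga (gen_hom G i)).
have elt d (x : forall i, D i) : (forall i, bihom (X := D i) d (x i)) -> C x ->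
    exists2 l : L, bihom (X := L) d l & forall i, pi i l = x i.
  move=> hx Cx; exists (oL (exist _ (d, x) (conj hx Cx)) 0).
    exact: (gen_deg G (exist _ (d, x) (conj hx Cx)) 0).
  by move=> i; rewrite (gen_op G).
split=> //.
- exact: (gen_inj G).
- move=> Y f g hf hg H; apply: (gen_ext G) => // u z _; apply: H => /=.
  rewrite (_ : (fun i => _) = (sval u).2); first exact: (svalP u).2.
  by apply: functional_extensionality_dep => i; rewrite (gen_op G).
- move=> Y q hq; apply: (gen_factor (F := fun i => q i) G).
    by move=> i; apply: tdga_is_hom.
  move=> d y hy; have [||l _ hl] := @elt d (fun i => q i y); last by exists l.
    by move=> i; apply: (is_hom_bihom (tdga_is_hom (q i)) hy).
  exact: hq.
Qed.

End FamilyLimit.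

Lemma dgat_complete (D : diagram (DGAT k r)) : has_limit D.
Proof.
pose C (x : forall i, D i : tdga k r) :=
  forall i j (e : @edge _ D i j), (dmor e : tdga_hom (D i) (D j)) (x i) = x j.
have [L [p H]] := family_limit_exists C.
exists L, p; split.
  move=> i j e; apply: hom_tdgaP => x /=.
  apply: (flim_ext H (f := fun x => (dmor e : tdga_hom (D i) (D j)) (p i x))
    (g := p j)) x.
  - exact: (is_hom_comp (tdga_is_hom (dmor e : tdga_hom (D i) (D j))) (tdga_is_hom (p i))).
  - exact: tdga_is_hom.
  - by move=> l; apply.
move=> X q hq; have [|h hh] := flim_map H (q := q).
  by move=> y i j e; rewrite -(hq i j e).
exists h; split=> [i|h' hh']; first by apply: hom_tdgaP => x; apply: hh.
apply: hom_tdgaP => x; apply: (flim_inj H) => i.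
by rewrite hh -(hh' i).
Qed.

Section InitialModel.
Variables (V : Type) (D : V -> tdga k r) (U : Type) (deg : U -> nat * weight).
Variable Phi : forall X : tdga k r, (forall v, tdga_hom (D v) X) -> (U -> X -> X) -> Prop.

(** A model is an algebra under all the [D v] with unary operations [o u] whose
    values have bidegree [deg u], subject to [Phi].  For arbitrary [Phi] the
    algebra generated by all models may fail to satisfy [Phi]; in each case
    below, that it does follows from [init_inj]. *)
Record is_model (X : tdga k r) (j : forall v, tdga_hom (D v) X) (o : U -> X -> X) :
  Prop := IsModel {
  model_deg : forall u x, bihom (X := X) (deg u) (o u x);
  model_prop : Phi j o
}.

Record is_initial_model (Z : tdga k r) (j : forall v, tdga_hom (D v) Z) (o : U -> Z -> Z) :
  Prop := IsInitialModel {
  init_deg : forall u z, bihom (X := Z) (deg u) (o u z);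
  init_map : forall X j' o', @is_model X j' o' -> exists h : tdga_hom Z X,
    (forall v a, h (j v a) = j' v a) /\ (forall u z, h (o u z) = o' u (h z));
  init_inj : forall z z' : Z, (forall X j' o' (h : tdga_hom Z X), @is_model X j' o' ->
    (forall v a, h (j v a) = j' v a) -> (forall u z, h (o u z) = o' u (h z)) ->
    h z = h z') -> z = z';
  init_ext : forall (Y : pretdga k r) (f g : Z -> Y), is_hom f -> is_hom g ->
    (forall v a, f (j v a) = g (j v a)) ->
    (forall u z, f z = g z -> f (o u z) = g (o u z)) -> f =1 g
}.

Record model := Model {
  model_obj : tdga k r;
  model_from : forall v, tdga_hom (D v) model_obj;
  model_op : U -> model_obj -> model_obj;
  modelP : is_model model_from model_op
}.

(** The bihomogeneous elements of the [D v] are treated as constants, and the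
    algebra is generated inside all models at once. *)
Lemma initial_model_exists : exists Z j o, @is_initial_model Z j o.
Proof.
pose B := {v : V & {p : (nat * weight) * D v | bihom (X := D v) p.1 p.2}}.
pose deg' (u : U + B) := match u with inl u => deg u | inr b => (sval (tagged b)).1 end.
pose op (M : model) (u : U + B) (x : model_obj M) : model_obj M :=
  match u with
  | inl u => model_op u x
  | inr b => model_from M (tag b) (sval (tagged b)).2
  end.
have ho (M : model) u x : bihom (X := model_obj M) (deg' u) (@op M u x).
  case: u => [u|[v [p hp]]] /=; first exact: (model_deg (modelP M)).
  exact: (is_hom_bihom (tdga_is_hom (model_from M v)) hp).
have [Z [oZ [pi G]]] := generated_exists hk ho.
have jex v : exists j : tdga_hom (D v) Z, forall M a, pi M (j a) = model_from M v a.
  apply: (gen_factor (F := fun M => model_from M v) G).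
    by move=> M; apply: tdga_is_hom.
  move=> d y hy; exists (oZ (inr (Tagged _ (exist _ (d, y) hy))) 0) => M.
  by rewrite (gen_op G).
pose j v := projT1 (cid (jex v)).
have jE v M a : pi M (j v a) = model_from M v a by rewrite /j; case: cid.
exists Z, j, (fun u => oZ (inl u)); split.
- by move=> u z; apply: (gen_deg G (inl u) z).
- move=> X j' o' hX; exists (hom_tdga (gen_hom G (Model hX))); split.
    by move=> v a; apply: (jE v (Model hX)).
  by move=> u z; exact: (gen_op G (Model hX) (inl u) z).
- move=> z z' H; apply: (gen_inj G) => M.
  apply: (H _ _ _ (hom_tdga (gen_hom G M)) (modelP M)).
    by move=> v a; apply: (jE v M).
  by move=> u x; apply: (gen_op G M (inl u) x).
- move=> Y f g hf hg Hj Ho; apply: (gen_ext G hf hg) => -[u z|[v [[d y] hy]] z _].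
    exact: Ho.
  suff -> : oZ (inr (Tagged _ (exist _ (d, y) hy))) z = j v y by apply: Hj.
  by apply: (gen_inj G) => M; rewrite jE (gen_op G).
Qed.

End InitialModel.

Lemma dgat_cocomplete (D : diagram (DGAT k r)) : has_colimit D.
Proof.
pose Phi (X : tdga k r) (q : forall v, tdga_hom (D v) X) (_ : void -> X -> X) :=
  @is_cocone (DGAT k r) D X q.
have [Z [p [o H]]] := @initial_model_exists (vertex D) D void (fun=> (0%N, 0)) Phi.
exists Z, p; split.
  move=> i j e; apply: hom_tdgaP => x; apply: (init_inj H) => X j' o' h hM hj _.
  have cX : @is_cocone (DGAT k r) D X j' := model_prop hM.
  by rewrite [RHS]hj -(cX i j e) /= hj.
move=> X q hq; have hM : is_model (fun=> (0%N, 0)) Phi q (fun u : void => match u with end).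
  by split.
have [h [hj _]] := init_map H hM.
exists h; split=> [i|h' hh']; first by apply: hom_tdgaP => x; apply: hj.
apply: hom_tdgaP; apply: (init_ext H); [exact: tdga_is_hom|exact: tdga_is_hom| |by case].
by move=> v a; rewrite hj -(hh' v).
Qed.

End LimitsAndModels.

(** * Bihomogeneous components and acyclic fibrations *)

Section DgaFacts.
Variable k : fieldType.
Variables (A B : dga k) (f : dga_hom A B).

Definition fibration : Prop := @dga_fib k A B f.
Definition weak_equivalence : Prop := @dga_weq k A B f.

Lemma homogZ (X : dga k) n a (x : X) : homog n x -> homog n (a *: x).
Proof. by move=> h; rewrite -[_ *: _]addr0; apply: homogP => //; apply: homog0. Qed.
Lemma homogD (X : dga k) n (x y : X) : homog n x -> homog n y -> homog n (x + y).
Proof. by move=> h; rewrite -[x]scale1r; apply: homogP. Qed.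
Lemma homogB (X : dga k) n (x y : X) : homog n x -> homog n y -> homog n (x - y).
Proof. by move=> h g; rewrite addrC -scaleN1r; apply: homogP. Qed.

Lemma boundary0 (X : dga k) n : dga_boundary n (0 : X).
Proof. by exists 0; [apply: homog0|rewrite linear0]. Qed.

(** Lift the homology class of [y], then correct the lift by the boundary of a
    lift of the error. *)
Lemma acyclic_fib_lift0 : fibration -> weak_equivalence ->
  forall y : B, homog 0 y -> exists2 x : A, homog 0 x & f x = y.
Proof.
move=> ff fw y hy; have [_ /(_ y)] := fw 0%N.
case=> [|x [hx _] [z hz Ez]]; first by split=> //; apply: dga_diff_homog0.
have [x1 hx1 Ex1] := ff 1%N isT z hz.
exists (x - dga_diff A x1); first by apply: homogB => //; apply: dga_diff_homogS.
by rewrite (linB (dga_funL f)) dga_fun_diff Ex1 Ez opprB addrC subrK.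
Qed.

(** As [x] bounds in [A], say [x = d x1], the error [f x1 - y] is a cycle;
    its homology class lifts to a cycle of [A], and the remaining error is a
    boundary, which lifts because [f] is surjective in positive degrees. *)
Lemma acyclic_fib_liftS : fibration -> weak_equivalence ->
  forall n (y : B) (x : A), homog n.+1 y -> homog n x -> dga_diff A x = 0 ->
  f x = dga_diff B y ->
  exists x' : A, [/\ homog n.+1 x', dga_diff A x' = x & f x' = y].
Proof.
move=> ff fw n y x hy hx dx fx.
have [injf _] := fw n; have [||x1 hx1 Ex1] := injf x; [by split|by exists y|].
have [_ /(_ (f x1 - y))] := fw n.+1.
case=> [|x2 [hx2 dx2] [z hz Ez]].
  split; first by apply: homogB => //; apply: dga_fun_homog.
  by rewrite linearB -dga_fun_diff Ex1 fx subrr.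
have [x3 hx3 Ex3] := ff n.+2 isT z hz.
exists (x1 - x2 + dga_diff A x3); split.
- by apply: homogD; [apply: homogB|apply: dga_diff_homogS].
- by rewrite linearD linearB Ex1 dx2 dga_diffK addr0 subr0.
- rewrite (linD (dga_funL f)) (linB (dga_funL f)) dga_fun_diff Ex3 Ez.
  by rewrite opprB addrA subrK addrC subrK.
Qed.
End DgaFacts.

Section Components.
Variables (k : fieldType) (hk : [pchar k] =i pred0) (r : nat).
Local Notation weight := (weight r).

Section OneAlgebra.
Variable A : tdga k r.
Implicit Types x : A.

Lemma component_exists (d : nat * weight) : exists G : A -> A, linear G /\
  forall e x, bihom (X := A) e x -> G x = if e == d then x else 0.
Proof.
apply: (bihom_extension (A := A) (V := A) hk (g := fun e x => if e == d then x else 0)).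
  exact: tdga_bispan.
by move=> e a x y; case: (e == d); rewrite ?scaler0 ?addr0.
Qed.

(** The projection to the bihomogeneous elements of bidegree [d]. *)
Definition component d := projT1 (cid (component_exists d)).
Lemma component_lin d : linear (component d).
Proof. by have [] := projT2 (cid (component_exists d)). Qed.
Lemma component_bihomE d e x : bihom (X := A) e x -> component d x = if e == d then x else 0.
Proof. by have [_] := projT2 (cid (component_exists d)); apply. Qed.
Lemma component_id d x : bihom (X := A) d x -> component d x = x.
Proof. by move=> /(component_bihomE d); rewrite eqxx. Qed.

Lemma component_bihom d x : bihom (X := A) d (component d x).
Proof.
elim: (tdga_bispan hk x) => [|e u v hu _ IH].
  by rewrite (lin0 (@component_lin d)); apply: bihom0.
rewrite (linD (@component_lin d)) (component_bihomE d hu); apply: bihomD => //.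
by case: eqP => [<-//|_]; apply: bihom0.
Qed.

Lemma component_diff n w x : dga_diff A (component (n.+1, w) x) = component (n, w) (dga_diff A x).
Proof.
apply: (lin_bispan_eq (A := A) (f := fun x => dga_diff A (component (n.+1, w) x))
   (g := fun x => component (n, w) (dga_diff A x))); last exact: tdga_bispan.
- by move=> a u v; rewrite component_lin linearP.
- by move=> a u v; rewrite linearP component_lin.
move=> [[|m] v] u hu; rewrite (component_bihomE _ hu).
  rewrite [dga_diff A u](bihom_diff0 hu) (lin0 (@component_lin _)).
  by rewrite xpair_eqE /= linear0.
rewrite (component_bihomE _ (bihom_diff hu)) !xpair_eqE eqSS.
by case: ifP => // _; rewrite linear0.
Qed.

Lemma sum_by_degree (s : seq (nat * weight)) (c : nat * weight -> A) N :
  (forall d, d \in s -> (d.1 < N)%N) ->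
  \sum_(d <- s) c d = \sum_(i < N) \sum_(d <- s | d.1 == i) c d.
Proof.
move=> H; rewrite (exchange_big_dep predT) //= big_seq [RHS]big_seq.
by apply: eq_bigr => d /H dN; rewrite (big_pred1 (Ordinal dN)).
Qed.

(** A homogeneous element is the sum of its weight components. *)
Lemma homog_component_ind (P : A -> Prop) n x :
  P 0 -> (forall y z, P y -> P z -> P (y + z)) -> homog n x ->
  (forall w, P (component (n, w) x)) -> P x.
Proof.
move=> P0 PD hx Px.
have [s [c [us hc Ex]]] := spanned_normal (@bihomP _ _ A) (@bihom0 _ _ A) (tdga_bispan hk x).
have cE d : d \in s -> component d x = c d.
  move=> ds; rewrite Ex (lin_sum (@component_lin d)) (bigD1_seq d) //= component_id //.
  rewrite big1 ?addr0 // => e /negbTE ed.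
  by rewrite (component_bihomE d (hc e)) ed.
pose N := (\max_(d <- s) d.1 + n).+1.
pose C i : A := \sum_(d <- s | d.1 == i) c d - (if i == n then x else 0).
have hC i : homog i (C i).
  apply: homogB; last by case: eqP => [-> //|_]; apply: homog0.
  apply: (big_ind (@homog _ A i)) => [|y z|d /eqP <-].
  - exact: homog0.
  - exact: homogD.
  - by have [] := hc d.
have nN : (n < N)%N by rewrite ltnS leq_addl.
have SC : \sum_(i < N) C i = 0.
  rewrite sumrB -sum_by_degree => [|d ds]; last first.
    rewrite ltnS; apply: leq_trans (leq_addr _ _).
    by apply: (@leq_bigmax_seq _ s predT (fun d => d.1) d).
  rewrite -Ex (bigD1 (Ordinal nN)) //= eqxx big1 ?addr0 ?subrr // => i.
  by rewrite -val_eqE /= => /negbTE ->.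
have := homog_direct hC SC nN; rewrite /C eqxx => /eqP; rewrite subr_eq0 => /eqP <-.
rewrite big_seq_cond; apply: (big_ind P) => // -[m w] /andP[ds /eqP /= mn].
by rewrite -cE // mn.
Qed.

End OneAlgebra.

Lemma component_hom (A B : tdga k r) (f : tdga_hom A B) d x : f (component d x) = component d (f x).
Proof.
apply: (lin_bispan_eq (A := A) (f := fun x => f (component d x))
   (g := fun x => component d (f x))); last exact: tdga_bispan.
- by move=> a u v; rewrite component_lin (dga_funL f).
- by move=> a u v; rewrite (dga_funL f) component_lin.
move=> e u hu; rewrite (component_bihomE _ hu).
rewrite (component_bihomE _ (is_hom_bihom (tdga_is_hom f) hu)).
by case: ifP => // _; rewrite (lin0 (dga_funL f)).
Qed.

Section Criterion.
Variables (A B : tdga k r) (f : tdga_hom A B).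

Lemma fib_bihom n w (y : B) : fibration f -> (0 < n)%N ->
  bihom (X := B) (n, w) y -> exists2 x : A, bihom (X := A) (n, w) x & f x = y.
Proof.
move=> ff n0 hy; have [x hx Ex] := ff n n0 y hy.1.
exists (component (n, w) x); first exact: component_bihom.
by rewrite component_hom Ex component_id.
Qed.

Lemma bihom_fib : (forall n w (y : B), (0 < n)%N -> bihom (X := B) (n, w) y ->
  exists2 x : A, bihom (X := A) (n, w) x & f x = y) -> fibration f.
Proof.
move=> H n n0 y hy.
apply: (homog_component_ind (P := fun y => exists2 x : A, homog n x & f x = y) _ _ hy).
- by exists 0; [apply: homog0|rewrite (lin0 (dga_funL f))].
- move=> u v [x hx <-] [x' hx' <-]; exists (x + x'); first exact: homogD.
  by rewrite (linD (dga_funL f)).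
- by move=> w; have [x [hx _] Ex] := H n w _ n0 (component_bihom (n, w) y); exists x.
Qed.

(** Lifting against the cells: a map from the boundary of a cell of
    dimension [n.+1] and weight [w] is a cycle of bidegree [(n, w)], and a map
    from the cell is any element of bidegree [(n.+1, w)]. *)
Record acyclic_lifting : Prop := AcyclicLifting {
  lift0 : forall w (y : B), bihom (X := B) (0%N, w) y ->
    exists2 x : A, bihom (X := A) (0%N, w) x & f x = y;
  liftS : forall n w (y : B) (x : A), bihom (X := B) (n.+1, w) y ->
    bihom (X := A) (n, w) x -> dga_diff A x = 0 -> f x = dga_diff B y ->
    exists x' : A, [/\ bihom (X := A) (n.+1, w) x', dga_diff A x' = x & f x' = y]
}.

(** Non-equivariant lifts exist; their bihomogeneous components are
    equivariant lifts. *)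
Lemma acyclic_fib_lifting : fibration f -> weak_equivalence f -> acyclic_lifting.
Proof.
move=> ff fw; split=> [w y hy|n w y x hy hx dx fx].
  have [x hx Ex] := acyclic_fib_lift0 ff fw hy.1.
  exists (component (0%N, w) x); first exact: component_bihom.
  by rewrite component_hom Ex component_id.
have [x' [hx' dx' Ex']] := acyclic_fib_liftS ff fw hy.1 hx.1 dx fx.
exists (component (n.+1, w) x'); split; first exact: component_bihom.
  by rewrite component_diff dx' component_id.
by rewrite component_hom Ex' component_id.
Qed.

Hypothesis L : acyclic_lifting.

(** Lift first the cycle [dga_diff B y], whose own boundary is zero, and then
    [y] over that lift. *)
Lemma acyclic_lifting_surj d (y : B) : bihom (X := B) d y ->
  exists2 x : A, bihom (X := A) d x & f x = y.
Proof.
case: d => -[|n] w hy; first exact: lift0.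
have [x hx [dx fx]] : exists2 x : A, bihom (X := A) (n, w) x
    & dga_diff A x = 0 /\ f x = dga_diff B y.
  case: n hy => [|n] hy.
    have [x hx fx] := lift0 L (bihom_diff hy); exists x => //.
    by split=> //; apply: (bihom_diff0 hx).
  have [||||x [hx dx fx]] := liftS L (n := n) (w := w) (x := 0) (y := dga_diff B y).
  - exact: bihom_diff hy.
  - exact: bihom0.
  - exact: linear0.
  - by rewrite (lin0 (dga_funL f)) dga_diffK.
  by exists x.
by have [x' [hx' _ fx']] := liftS L hy hx dx fx; exists x'.
Qed.

Lemma acyclic_lifting_fib : fibration f.
Proof. by apply: bihom_fib => n w y _ /acyclic_lifting_surj. Qed.

Lemma acyclic_lifting_weq : weak_equivalence f.
Proof.
move=> n; split=> [x [hx dx] [y hy dy]|y [hy dy]].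
  apply: (homog_component_ind (P := @dga_boundary _ A n) _ _ hx).
  - exact: boundary0.
  - move=> _ _ [u hu <-] [v hv <-]; exists (u + v); first exact: homogD.
    by rewrite linearD.
  move=> w; have [||||x' [[hx' _] dx' _]] := liftS L (n := n) (w := w)
    (x := component (n, w) x) (y := component (n.+1, w) y).
  - exact: component_bihom.
  - exact: component_bihom.
  - case: n hx {hy dy} => [|n] hx; last first.
      by rewrite component_diff dx (lin0 (@component_lin _ _)).
    by apply: (bihom_diff0 (component_bihom (0%N, w) x)).
  - by rewrite component_hom component_diff dy.
  by exists x'.
apply: (homog_component_ind (P := fun y => exists2 x : A, dga_cycle n x
  & dga_boundary n (f x - y)) _ _ hy).
- exists 0; first by split; [apply: homog0|rewrite linear0].
  by rewrite (lin0 (dga_funL f)) subr0; apply: boundary0.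
- move=> u v [x [hx dx] [x' hx' Ex]] [z [hz dz] [z' hz' Ez]].
  exists (x + z); first by split; [apply: homogD|rewrite linearD dx dz addr0].
  exists (x' + z'); first exact: homogD.
  by rewrite linearD Ex Ez (linD (dga_funL f)) opprD addrACA.
move=> w; case: n hy dy => [|n] hy dy.
  have [x hx Ex] := lift0 L (component_bihom (0%N, w) y).
  exists x; first by split; [exact: hx.1|apply: (bihom_diff0 hx)].
  by rewrite Ex subrr; apply: boundary0.
have [||||x [hx dx Ex]] := liftS L (n := n) (w := w) (x := 0) (y := component (n.+1, w) y).
- exact: component_bihom.
- exact: bihom0.
- exact: linear0.
- by rewrite (lin0 (dga_funL f)) component_diff dy (lin0 (@component_lin _ _)).
exists x; first by split; [exact: hx.1|].
by rewrite Ex subrr; apply: boundary0.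
Qed.

End Criterion.
End Components.

(** * The path algebra and the factorization by an acyclic cofibration *)

Section Path.
Variables (k : fieldType) (hk : [pchar k] =i pred0) (r : nat).
Variable Z : tdga k r.
Implicit Types x y b : Z.

Lemma invol_exists : exists G : Z -> Z, linear G /\
  forall e x, bihom (X := Z) e x -> G x = (-1) ^+ e.1 *: x.
Proof.
apply: (bihom_extension (A := Z) (V := Z) hk (g := fun e x => (-1) ^+ e.1 *: x)).
  exact: tdga_bispan.
by move=> e a x y; rewrite scalerDr !scalerA mulrC.
Qed.

(** The grading involution [x |-> (-1)^n x]. *)
Definition invol := projT1 (cid invol_exists).
Lemma invol_lin : linear invol.
Proof. by have [] := projT2 (cid invol_exists). Qed.
Lemma invol_bihom e x : bihom (X := Z) e x -> invol x = (-1) ^+ e.1 *: x.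
Proof. by have [_] := projT2 (cid invol_exists); apply. Qed.

Lemma invol_homog n x : homog n x -> invol x = (-1) ^+ n *: x.
Proof.
move=> hx; apply: (homog_component_ind (hk := hk) (P := fun x => invol x = (-1) ^+ n *: x) _ _ hx).
- by rewrite (lin0 invol_lin) scaler0.
- by move=> y z Ey Ez; rewrite (linD invol_lin) Ey Ez scalerDr.
- by move=> w; apply: (invol_bihom (component_bihom hk (n, w) x)).
Qed.

Lemma invol1 : invol (aone Z) = aone Z.
Proof. by rewrite (invol_homog (homog1 Z)) scale1r. Qed.

Lemma involM x y : invol (x ** y) = invol x ** invol y.
Proof.
apply: (lin_bispan_eq (A := Z) (f := fun x => invol (x ** y))
  (g := fun x => invol x ** invol y)) (tdga_bispan hk x).
- by move=> a u v; rewrite amulPl invol_lin.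
- by move=> a u v; rewrite invol_lin amulPl.
move=> d u hu; apply: (lin_bispan_eq (A := Z) (f := fun y => invol (u ** y))
  (g := fun y => invol u ** invol y)) (tdga_bispan hk y).
- by move=> a v w; rewrite amulPr invol_lin.
- by move=> a v w; rewrite invol_lin amulPr.
move=> e v hv; rewrite (invol_bihom (bihomM hu hv)) (invol_bihom hu) (invol_bihom hv).
by rewrite amulZl amulZr scalerA exprD.
Qed.

Lemma invol_diff x : invol (dga_diff Z x) = - dga_diff Z (invol x).
Proof.
apply: (lin_bispan_eq (A := Z) (f := fun x => invol (dga_diff Z x))
  (g := fun x => - dga_diff Z (invol x))) (tdga_bispan hk x).
- by move=> a u v; rewrite linearP invol_lin.
- by move=> a u v; rewrite invol_lin linearP opprD scalerN.
move=> [[|n] w] u hu; rewrite (invol_bihom hu) linearZ /=.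
  by rewrite [dga_diff Z u](bihom_diff0 hu) (lin0 invol_lin) scaler0 oppr0.
by rewrite (invol_bihom (bihom_diff hu)) /= exprS mulN1r scaleNr opprK.
Qed.

Lemma invol_act t x : invol (tact Z t x) = tact Z t (invol x).
Proof.
apply: (lin_bispan_eq (A := Z) (f := fun x => invol (tact Z t x))
  (g := fun x => tact Z t (invol x))) (tdga_bispan hk x).
- by move=> a u v; rewrite (dga_funL (tact Z t)) invol_lin.
- by move=> a u v; rewrite invol_lin (dga_funL (tact Z t)).
move=> e u hu; rewrite (invol_bihom (bihom_act t hu)) (invol_bihom hu).
by rewrite (linZ (dga_funL (tact Z t))).
Qed.

Definition path_type : lmodType k := (Z * Z * Z)%type.
Implicit Types u v w : path_type.

(** The product of triples is that of the upper triangular matrices with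
    diagonal [(x, y)] and corner [b]; the involution carries the Koszul sign
    caused by the degree shift of the corner.  A map to such triples is a pair
    of algebra maps together with a twisted derivation between them. *)
Definition path_mul u v : path_type :=
  (u.1.1 ** v.1.1, invol u.1.1 ** v.1.2 + u.1.2 ** v.2, u.2 ** v.2).
Definition path_one : path_type := (aone Z, 0, aone Z).
Definition path_diff u : path_type :=
  (dga_diff Z u.1.1, u.1.1 - u.2 - dga_diff Z u.1.2, dga_diff Z u.2).
(** The corner is shifted by one degree, so that [path_diff] would map degree
    [0] to the component [x - y - d b] of degree [-1]; the condition in degree
    [0] says that this component vanishes. *)
Definition path_homog n u :=
  [/\ homog n u.1.1, homog n.+1 u.1.2, homog n u.2
    & n = 0%N -> u.1.1 - u.2 = dga_diff Z u.1.2].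
Definition path_act t u : path_type := (tact Z t u.1.1, tact Z t u.1.2, tact Z t u.2).

Lemma path_eq u v : u.1.1 = v.1.1 -> u.1.2 = v.1.2 -> u.2 = v.2 -> u = v.
Proof. by case: u v => [[? ?] ?] [[? ?] ?] /= -> -> ->. Qed.

Definition path_algebra : algebra k.
Proof.
apply: (@Algebra k path_type path_mul path_one).
- move=> u v w; apply: path_eq; rewrite /= ?amulA //.
  by rewrite amulDr amulDl involM !amulA addrA.
- by move=> u; apply: path_eq; rewrite /= ?amul1x // invol1 amul1x amul0x addr0.
- by move=> u; apply: path_eq; rewrite /= ?amulx1 // amulx0 add0r.
- move=> w a u v; apply: path_eq; rewrite /= ?amulPl //.
  by rewrite invol_lin !amulPl scalerDr addrACA.
- move=> w a u v; apply: path_eq; rewrite /= ?amulPr //.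
  by rewrite scalerDr addrACA.
Defined.

Lemma path_diff_lin : linear path_diff.
Proof.
move=> a u v; apply: path_eq; rewrite /= !(linearP (dga_diff Z)) //.
rewrite !scalerBr !opprD !addrA. by rewrite [LHS](ACl (1*3*5*2*4*6))%AC.
Qed.

Lemma path_homogM i j u v :
  path_homog i u -> path_homog j v -> path_homog (i + j) (path_mul u v).
Proof.
move=> [x b y e] [x' b' y' e']; split=> /=.
- exact: homogM.
- apply: homogD; last by rewrite -addSn; apply: homogM.
  rewrite -addnS; apply: homogM => //; rewrite (invol_homog x).
  exact: homogZ.
- exact: homogM.
case: i j => [|i] [|j] // in x b y e x' b' y' e' * => _.
rewrite linearD (invol_homog x) expr0 scale1r (dga_diffM _ x) (dga_diffM _ b).
rewrite (dga_diff_homog0 x) (dga_diff_homog0 y') amul0x add0r amulx0 scaler0 addr0.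
by rewrite expr0 scale1r -e // -e' // amulBl amulBr addrA subrK.
Qed.

Lemma path_diffM i u v : path_homog i u -> path_diff (path_mul u v) =
  path_mul (path_diff u) v + (-1) ^+ i *: path_mul u (path_diff v).
Proof.
move=> [x b y _]; apply: path_eq; rewrite /= ?(dga_diffM _ x) ?(dga_diffM _ y) //.
rewrite invol_diff (invol_homog x) linearZ linearD /= !amulZl linearZ /=.
rewrite (dga_diffM _ x) (dga_diffM _ b) exprS mulN1r scaleNr.
rewrite !(amulBl, amulBr, amulNl, amulZl, scalerDr, scalerBr, scalerN, scalerA).
have -> : (-1) ^+ i * (-1) ^+ i = 1 :> k by rewrite -expr2 sqrr_sign.
rewrite !scale1r !opprD !opprK !addrA [RHS](ACl (2*6*5*3*1*7*4*8))%AC /=.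
by rewrite subrr add0r.
Qed.

Definition path_pre : pretdga k r.
Proof.
apply: (@Pretdga k r path_algebra path_homog path_diff path_act).
- exact: path_diff_lin.
- move=> n; split; rewrite /= ?subrr ?linear0 //; exact: homog0.
- move=> n a u v [x b y e] [x' b' y' e']; split; rewrite /= ?(linearP (dga_diff Z)); try exact: homogP.
  by move=> n0; rewrite -(e n0) -(e' n0) scalerBr opprD addrACA.
- move=> n c hc H i lin; apply: path_eq.
  + apply: (homog_direct (c := fun i => (c i).1.1)) lin => [j|]; first by have [] := hc j.
    by have := congr1 (fun u => u.1.1) H; rewrite /= !raddf_sum.
  + suff H0 : forall j, homog j.+1 (c j).1.2 /\ \sum_(i < n) (c i).1.2 = 0.
      (* The corners have degree [j.+1]; degree [0] is filled with [0]. *)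
      apply: (homog_direct (n := n.+1) (c := fun j => if j is j'.+1 then (c j').1.2 else 0) _ _ (i := i.+1)) lin.
      * by case=> [|j]; [apply: homog0|have [] := H0 j].
      * by rewrite big_ord_recl add0r; have [] := H0 0%N.
    move=> j; split; first by have [] := hc j.
    by have := congr1 (fun u => u.1.2) H; rewrite /= !raddf_sum.
  + apply: (homog_direct (c := fun i => (c i).2)) lin => [j|]; first by have [] := hc j.
    by have := congr1 (fun u => u.2) H; rewrite /= !raddf_sum.
- split; [exact: homog1|exact: homog0|exact: homog1|].
  by rewrite /= subrr linear0.
- exact: path_homogM.
- move=> u [x b y e]; apply: path_eq => /=; try exact: dga_diff_homog0.
  by rewrite e // subrr.
- move=> n u [x b y _]; split=> /=; try exact: dga_diff_homogS.
    apply: homogB; last exact: dga_diff_homogS.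
    exact: homogB.
  by move=> _; rewrite !(linearB (dga_diff Z)) dga_diffK subr0.
- move=> u; apply: path_eq => /=; try exact: dga_diffK.
  by rewrite !(linearB (dga_diff Z)) dga_diffK subr0 subrr.
- exact: path_diffM.
- by move=> t a u v; apply: path_eq => /=; apply: dga_funL.
- move=> t; apply: path_eq => /=; rewrite ?dga_fun1 //.
  exact: lin0 (dga_funL _).
- move=> t u v; apply: path_eq; rewrite /= ?dga_funM //.
  by rewrite (linD (dga_funL (tact Z t))) !dga_funM invol_act.
- move=> t n u [x b y e]; split=> /=; try exact: dga_fun_homog.
  by move=> /e E; rewrite -(linB (dga_funL (tact Z t))) E dga_fun_diff.
- move=> t u; apply: path_eq; rewrite /= ?dga_fun_diff //.
  by rewrite !(linB (dga_funL (tact Z t))) dga_fun_diff.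
- by move=> u; apply: path_eq; rewrite /= tact1.
- by move=> s t u; apply: path_eq; rewrite /= tactM.
Defined.

Lemma path_source_hom : @is_hom k r path_pre Z (fun u : path_type => u.1.1).
Proof. by split=> // n u []. Qed.
Lemma path_target_hom : @is_hom k r path_pre Z (fun u : path_type => u.2).
Proof. by split=> // n u []. Qed.
Lemma path_const_hom : @is_hom k r Z path_pre (fun x : Z => (x, 0, x) : path_type).
Proof.
split=> [a x y||x y|n x hx|x|t x]; rewrite ?/path_type.
- by apply: path_eq; rewrite //= scaler0 addr0.
- by [].
- by apply: path_eq; rewrite //= amulx0 amul0x addr0.
- by split=> //=; [apply: homog0|rewrite subrr linear0].
- by apply: path_eq; rewrite //= subrr linear0 subr0.
- by apply: path_eq; rewrite //= (lin0 (dga_funL (tact Z t))).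
Qed.

(** Commutation of [h] with differentials says that the corner of [h] is a
    chain homotopy from the identity to [g]. *)
Lemma path_homotopy (h : Z -> path_pre) (g : Z -> Z) : @is_hom k r Z path_pre h ->
  (forall z, (h z).1.1 = z) -> (forall z, (h z).2 = g z) ->
  forall n z, dga_cycle n z -> dga_boundary n (g z - z).
Proof.
move=> hh h1 h2 n z [hz dz]; exists (- (h z).1.2).
  by rewrite -scaleN1r; apply: homogZ; have [] := hom_homog hh hz.
have := congr1 (fun u : path_type => u.1.2) (hom_diff hh z).
rewrite [pdiff z]dz (lin0 (hom_lin hh)) /= h1 h2 => /eqP.
by rewrite eq_sym subr_eq0 => /eqP E; rewrite linearN -E opprB.
Qed.

End Path.

Section AcyclicFactorization.
Variables (k : fieldType) (hk : [pchar k] =i pred0) (r : nat).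
Local Notation weight := (weight r).

(** The new generators map to the given elements [b], so that [q] is
    surjective in positive degrees.  They can be sent to arbitrary
    bihomogeneous elements, whence the lifting property against fibrations. *)
Lemma acyclic_cofibration_factorization (A B : tdga k r) (f : tdga_hom A B) :
  exists (Z : tdga k r) (j : tdga_hom A Z) (q : tdga_hom Z B),
  [/\ forall a, q (j a) = f a, fibration q, weak_equivalence j
    & forall (X Y : tdga k r) (p : tdga_hom X Y) (u : tdga_hom A X) (v : tdga_hom Z Y),
      fibration p -> (forall a, p (u a) = v (j a)) ->
      exists h : tdga_hom Z X, (forall a, h (j a) = u a) /\ (forall z, p (h z) = v z)].
Proof.
pose U := {db : (nat * weight) * B | (0 < db.1.1)%N /\ bihom (X := B) db.1 db.2}.
pose deg (b : U) := (sval b).1.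
pose Phi (X : tdga k r) (_ : unit -> tdga_hom A X) (o : U -> X -> X) :=
  forall b x y, o b x = o b y.
have [Z [j' [o H]]] := @initial_model_exists k hk r unit (fun=> A) U deg Phi.
pose j := j' tt.
have oC b x y : o b x = o b y.
  apply: (init_inj H) => X i' o' h hM _ ho; rewrite !ho.
  exact: (model_prop hM).
have ext (X : tdga k r) (u : tdga_hom A X) (x : U -> X) :
    (forall b, bihom (X := X) (deg b) (x b)) ->
    exists h : tdga_hom Z X, (forall a, h (j a) = u a) /\ (forall b z, h (o b z) = x b).
  move=> hx; have hM : is_model deg Phi (fun=> u) (fun b _ => x b) by split.
  have [h [hj ho]] := init_map H hM.
  by exists h; split=> [a|b z]; [apply: hj|rewrite ho].
have ext_eq (Y : pretdga k r) (g h : Z -> Y) : is_hom g -> is_hom h ->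
    (forall a, g (j a) = h (j a)) -> (forall b, g (o b 0) = h (o b 0)) -> g =1 h.
  move=> hg hh Ej Eo; apply: (init_ext H) => // [[] a|b z _]; first exact: Ej.
  by rewrite (oC b z 0) Eo.
have [q [qj qo]] := ext B f (fun b => (sval b).2) (fun b => (svalP b).2).
exists Z, j, q; split=> //.
- apply: bihom_fib => // n w y n0 hy.
  exists (o (exist _ ((n, w), y) (conj n0 hy)) 0); last by rewrite qo.
  exact: (init_deg H (exist _ ((n, w), y) (conj n0 hy)) 0).
(* The retraction [p] kills the generators. *)
- have [p [pj po]] := ext A (tdga_id A) (fun=> 0) (fun b => bihom0 A _).
  pose dP (e : {d : nat * weight & {x : path_pre hk Z | bihom d x}}) := tag e.
  have [P [oP [pi G]]] := generated_exists hk (deg := dP) (X := fun _ : unit => path_pre hk Z)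
    (o := fun _ e _ => sval (tagged e)) (fun _ e _ => svalP (tagged e)).
  have elt d (x : path_pre hk Z) : bihom d x ->
      exists2 z : P, bihom (X := P) d z & pi tt z = x.
    move=> hx; exists (oP (Tagged _ (exist _ x hx)) 0).
      exact: (gen_deg G (Tagged _ (exist _ x hx)) 0).
    by rewrite (gen_op G).
  pose F (_ : unit) (a : A) : path_pre hk Z := (j a, 0, j a) : path_type Z.
  have hF i : @is_hom k r A (path_pre hk Z) (F i).
    exact: (is_hom_comp (path_const_hom hk Z) (tdga_is_hom j)).
  have [|u hu] := gen_factor hk (F := F) G hF.
    move=> d a /(is_hom_bihom (hF tt)) /elt [z _ hz].
    by exists z => -[].
  (* The generator [o b 0] goes to the triple from itself to [0] with zero corner. Its
     degree is positive, so there is no condition on the corner. *)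
  have hpath b : bihom (X := path_pre hk Z) (deg b) ((o b 0, 0, 0) : path_type Z).
    have [ho to] := init_deg H b 0; have [d0 _] := svalP b.
    split=> [|t]; last first.
      by apply: path_eq; rewrite /= ?(lin0 (dga_funL (tact Z t))) ?scaler0 //; apply: to.
    split=> //=; try exact: homog0.
    by move=> E; rewrite -/(deg b) E in d0.
  pose x b := projT1 (cid2 (elt _ _ (hpath b))).
  have [hx hpx] : (forall b, bihom (X := P) (deg b) (x b))
      /\ forall b, pi tt (x b) = ((o b 0, 0, 0) : path_type Z).
    by split=> b; rewrite /x; case: (cid2 _).
  have [h [hj ho]] := ext P u x hx.
  have hh : @is_hom k r Z (path_pre hk Z) (pi tt \o h).
    exact: (is_hom_comp (gen_hom G tt) (tdga_is_hom h)).
  have h1 z : (pi tt (h z)).1.1 = z.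
    apply: (ext_eq Z (fun z => (pi tt (h z)).1.1) id) => //.
    - exact: (is_hom_comp (path_source_hom hk Z) hh).
    - by move=> a; rewrite hj hu.
    - by move=> b; rewrite ho hpx.
  have h2 z : (pi tt (h z)).2 = j (p z).
    apply: (ext_eq Z (fun z => (pi tt (h z)).2) (fun z => j (p z))).
    - exact: (is_hom_comp (path_target_hom hk Z) hh).
    - exact: (is_hom_comp (tdga_is_hom j) (tdga_is_hom p)).
    - by move=> a; rewrite hj hu pj.
    - by move=> b; rewrite ho hpx po (lin0 (dga_funL j)).
  have hom := path_homotopy hh h1 h2.
  move=> n; split=> [a [ha da] [z hz Ez]|z hz].
    exists (p z); first exact: dga_fun_homog.
    by rewrite -dga_fun_diff Ez pj.
  exists (p z); last exact: hom.
  case: hz => hz dz; split; first exact: dga_fun_homog.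
  by rewrite -dga_fun_diff dz (lin0 (dga_funL p)).
- move=> X Y p u v fp sq.
  have lift b : exists2 x : X, bihom (X := X) (deg b) x & p x = v (o b 0).
    have hb := is_hom_bihom (tdga_is_hom v) (init_deg H b 0).
    have [d0 _] := svalP b.
    move: hb d0; rewrite -/(deg b); case: (deg b) => n w hb n0.
    exact: (fib_bihom hk fp n0 hb).
  pose x b := projT1 (cid2 (lift b)).
  have [hx px] : (forall b, bihom (X := X) (deg b) (x b))
      /\ forall b, p (x b) = v (o b 0).
    by split=> b; rewrite /x; case: (cid2 _).
  have [h [hj ho]] := ext X u x hx.
  exists h; split=> // z.
  apply: (ext_eq Y (fun z => p (h z)) v) => [| |a|b].
  - exact: (is_hom_comp (tdga_is_hom p) (tdga_is_hom h)).
  - exact: tdga_is_hom.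
  - by rewrite hj sq.
  - by rewrite ho px.
Qed.

End AcyclicFactorization.

(** * The factorization by an acyclic fibration *)

Section CofibrationFactorization.
Variables (k : fieldType) (hk : [pchar k] =i pred0) (r : nat).
Local Notation weight := (weight r).

(** A limit in which the third leg is determined by the other two. *)
Lemma pullback_exists (Z X Y : tdga k r) (v : tdga_hom Z Y) (p : tdga_hom X Y) :
  exists (W : tdga k r) (p1 : tdga_hom W Z) (p2 : tdga_hom W X),
  [/\ forall w, v (p1 w) = p (p2 w),
      forall w w' : W, p1 w = p1 w' -> p2 w = p2 w' -> w = w',
      forall d z x, bihom (X := Z) d z -> bihom (X := X) d x -> v z = p x ->
        exists w, [/\ bihom (X := W) d w, p1 w = z & p2 w = x]
    & forall (A : tdga k r) (a : tdga_hom A Z) (b : tdga_hom A X),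
        (forall y, v (a y) = p (b y)) ->
        exists h : tdga_hom A W, forall y, p1 (h y) = a y /\ p2 (h y) = b y].
Proof.
pose D (b : bool) := if b then Z else X.
pose C (x : forall b, D b) := v (x true) = p (x false).
have [W [q H]] := family_limit_exists hk C.
pose p1 : tdga_hom W Z := q true; pose p2 : tdga_hom W X := q false.
exists W, p1, p2; split.
- apply: (flim_ext H (f := fun w => v (p1 w)) (g := fun w => p (p2 w))) => //.
  + exact: (is_hom_comp (tdga_is_hom v) (tdga_is_hom p1)).
  + exact: (is_hom_comp (tdga_is_hom p) (tdga_is_hom p2)).
- by move=> w w' e1 e2; apply: (flim_inj H) => -[].
- move=> d z x hz hx E.
  pose F (b : bool) : D b := match b with true => z | false => x end.
  have [||w hw Ew] := flim_elt H (d := d) (x := F) => [[]//|//|].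
  by exists w; split; [|exact: (Ew true)|exact: (Ew false)].
- move=> A a b E; pose F (c : bool) : tdga_hom A (D c) := match c with true => a | false => b end.
  have [//|h hh] := flim_map H (q := F).
  by exists h => y; split; [exact: (hh true)|exact: (hh false)].
Qed.

(** The operation [o b] attached to [b : B] turns a boundary condition [x] for
    a cell over [b] into a filler [o b x] over [b].  It has to be defined for
    all [x], but [fills] constrains it only where the cell exists. *)
Lemma cofibration_factorization (A B : tdga k r) (f : tdga_hom A B) :
  exists (Z : tdga k r) (j : tdga_hom A Z) (q : tdga_hom Z B),
  [/\ forall a, q (j a) = f a, acyclic_lifting q
    & forall (X Y : tdga k r) (p : tdga_hom X Y) (u : tdga_hom A X) (v : tdga_hom Z Y),
      acyclic_lifting p -> (forall a, p (u a) = v (j a)) ->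
      exists h : tdga_hom Z X, (forall a, h (j a) = u a) /\ (forall z, p (h z) = v z)].
Proof.
pose U := {db : (nat * weight) * B | bihom (X := B) db.1 db.2}.
pose deg (b : U) := (sval b).1.
pose val (b : U) : B := (sval b).2.
pose fills (X : tdga k r) (q : tdga_hom X B) (b : U) (x x' : X) :=
  forall n, (deg b).1 = n.+1 -> bihom (X := X) (n, (deg b).2) x ->
  dga_diff X x = 0 -> q x = dga_diff B (val b) -> dga_diff X x' = x.
pose Phi (X : tdga k r) (j : unit -> tdga_hom A X) (o : U -> X -> X) :=
  exists q : tdga_hom X B, [/\ forall a, q (j tt a) = f a,
    forall b x, q (o b x) = val b & forall b x, fills X q b x (o b x)].
have [Z [j' [o H]]] := @initial_model_exists k hk r unit (fun=> A) U deg Phi.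
pose j := j' tt.
(* [B] itself is a model; initiality gives the map to [B]. *)
have hB : is_model deg Phi (fun=> f) (fun b (_ : B) => val b).
  split; first by move=> b x; apply: (svalP b).
  by exists (tdga_id B); split=> // b x n _ _ _ /= ->.
have [q [qj qo]] := init_map H hB.
have q_fills b z : fills Z q b z (o b z).
  move=> n Eb hz dz qz; apply: (init_inj H) => X jX oX h hX hj ho.
  have [qX [qXj qXo fX]] := model_prop hX.
  rewrite dga_fun_diff ho; apply: (fX _ _ n) => //.
  - exact: (is_hom_bihom (tdga_is_hom h) hz).
  - by rewrite -dga_fun_diff dz (lin0 (dga_funL h)).
  rewrite -qz; apply: (init_ext H (f := fun z => qX (h z)) (g := q)).
  - exact: (is_hom_comp (tdga_is_hom qX) (tdga_is_hom h)).
  - exact: tdga_is_hom.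
  - by move=> [] a; rewrite hj qXj qj.
  - by move=> c x _; rewrite ho qXo qo.
exists Z, j, q; split.
- by move=> a; apply: qj.
- split=> [w y hy|n w y x hy hx dx qx].
    exists (o (exist _ (_, y) hy) 0); first exact: (init_deg H (exist _ (_, y) hy)).
    by rewrite qo.
  exists (o (exist _ (_, y) hy) x); split.
  + exact: (init_deg H (exist _ (_, y) hy)).
  + by apply: (q_fills (exist _ (_, y) hy) x n).
  + by rewrite qo.
move=> X Y p u v hp sq.
(* The pullback is a model: fill in [Z] by [o], and then in [X] over that filler. *)
have [W [p1 [p2 [Wsq Winj Welt Wmap]]]] := pullback_exists v p.
have [jW hjW] := Wmap A j u (fun a => esym (sq a)).
pose qW : tdga_hom W B := tdga_comp q p1.
have oW_exists b w : exists w' : W, [/\ bihom (X := W) (deg b) w',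
    p1 w' = o b (p1 w) & fills W qW b w w'].
  pose z' := o b (p1 w).
  have hz' : bihom (X := Z) (deg b) z' := init_deg H b (p1 w).
  have hvz' : bihom (X := Y) (deg b) (v z') := is_hom_bihom (tdga_is_hom v) hz'.
  have [x [hx px fx]] : exists x : X, [/\ bihom (X := X) (deg b) x, p x = v z'
      & forall n, (deg b).1 = n.+1 -> bihom (X := W) (n, (deg b).2) w ->
        dga_diff W w = 0 -> qW w = dga_diff B (val b) -> dga_diff X x = p2 w].
    case: (pselect (exists n, [/\ (deg b).1 = n.+1, bihom (X := W) (n, (deg b).2) w,
        dga_diff W w = 0 & qW w = dga_diff B (val b)])).
      move=> [n [En hw dw qw]].
      have degE : deg b = (n.+1, (deg b).2) by rewrite -En; case: (deg b).
      have [||||x [hx dx px]] := liftS hp (n := n) (w := (deg b).2) (y := v z') (x := p2 w).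
      + by rewrite -degE.
      + exact: (is_hom_bihom (tdga_is_hom p2) hw).
      + by rewrite -dga_fun_diff dw (lin0 (dga_funL p2)).
      + rewrite -Wsq -dga_fun_diff (q_fills b (p1 w) n) //.
          exact: (is_hom_bihom (tdga_is_hom p1) hw).
        by rewrite -dga_fun_diff dw (lin0 (dga_funL p1)).
      by exists x; split=> //; rewrite degE.
    (* Without a cell to fill, any element over [v z'] will do. *)
    move=> nex; have [x hx px] := acyclic_lifting_surj hp hvz'.
    by exists x; split=> // n *; case: nex; exists n.
  have [w' [hw' p1w' p2w']] := Welt _ _ _ hz' hx (esym px).
  exists w'; split=> // n En hw dw qw; apply: Winj.
    rewrite dga_fun_diff p1w'; apply: (q_fills b (p1 w) n) => //.
      exact: (is_hom_bihom (tdga_is_hom p1) hw).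
    by rewrite -dga_fun_diff dw (lin0 (dga_funL p1)).
  by rewrite dga_fun_diff p2w'; apply: fx En hw dw qw.
pose oW b w := projT1 (cid (oW_exists b w)).
have oWP b w : [/\ bihom (X := W) (deg b) (oW b w),
    p1 (oW b w) = o b (p1 w) & fills W qW b w (oW b w)].
  exact: projT2 (cid (oW_exists b w)).
have hW : is_model deg Phi (fun=> jW) oW.
  split; first by move=> b w; have [] := oWP b w.
  exists qW; split=> [a|b w|b w]; last by have [] := oWP b w.
    by rewrite /= (hjW a).1 qj.
  by have [_ /= -> _] := oWP b w; rewrite qo.
have [h [hj ho]] := init_map H hW.
(* By initiality [h] is a section of the pullback. *)
have p1h z : p1 (h z) = z.
  apply: (init_ext H (f := fun z => p1 (h z)) (g := id)) => //.
  - exact: (is_hom_comp (tdga_is_hom p1) (tdga_is_hom h)).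
  - by move=> [] a; rewrite hj (hjW a).1.
  - by move=> b w E; rewrite ho; have [_ -> _] := oWP b (h w); rewrite E.
exists (tdga_comp p2 h); split=> [a|z] /=.
  by rewrite hj (hjW a).2.
by rewrite -Wsq p1h.
Qed.

End CofibrationFactorization.

(** * The right adjoint of the forgetful functor *)

Section Coinduction.
Variables (k : fieldType) (hk : [pchar k] =i pred0) (r : nat).
Local Notation T := (torus k r).
Local Notation weight := (weight r).

Section FunctionAlgebra.
Variable C : dga k.
Definition fun_type : lmodType k := (T -> C).
Implicit Types F G : fun_type.

Definition fun_algebra : algebra k.
Proof.
apply: (@Algebra k fun_type (fun F G t => F t ** G t) (fun=> aone C)).
- by move=> F G H; apply/funext => t; rewrite amulA.
- by move=> F; apply/funext => t; rewrite amul1x.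
- by move=> F; apply/funext => t; rewrite amulx1.
- by move=> H a F G; apply/funext => t; rewrite [LHS]amulPl.
- by move=> H a F G; apply/funext => t; rewrite [LHS]amulPr.
Defined.

(** The torus acts by translating the argument of functions. *)
Definition fun_pre : pretdga k r.
Proof.
apply: (@Pretdga k r fun_algebra (fun n F => forall t, homog n (F t))
  (fun F t => dga_diff C (F t)) (fun s F t => F (t * s)%g)).
- by move=> a F G; apply/funext => t; rewrite [LHS]linearP.
- by move=> n t; apply: homog0.
- by move=> n a F G hF hG t; apply: homogP.
- move=> n c hc H i lin; apply/funext => t.
  apply: (homog_direct (c := fun i => c i t)) lin => [j|]; first exact: hc.
  by have := congr1 (fun F : fun_type => F t) H; rewrite fct_sumE.
- by move=> t; apply: homog1.
- by move=> i j F G hF hG t; apply: homogM.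
- by move=> F hF; apply/funext => t; apply: dga_diff_homog0.
- by move=> n F hF t; apply: dga_diff_homogS.
- by move=> F; apply/funext => t; apply: dga_diffK.
- by move=> i F G hF; apply/funext => t; rewrite [LHS](dga_diffM _ (hF t)).
- by [].
- by [].
- by [].
- by move=> s n F hF t; apply: hF.
- by [].
- by move=> F; apply/funext => t; rewrite mulg1.
- by move=> s t F; apply/funext => t'; rewrite mulgA.
Defined.

(** A function of weight [w] is a multiple of the character [chi w]; the
    factor is its value at [1]. *)
Lemma fun_bihomE n w F : bihom (X := fun_pre) (n, w) F <->
  homog n (F 1%g) /\ forall t, F t = chi w t *: F 1%g.
Proof.
split=> [[hF tF]|[hF tF]].
  split=> [|t]; first exact: hF.
  have := congr1 (fun G : fun_type => G 1%g) (tF t) => /=.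
  by rewrite mul1g.
split=> [t|t] /=; first by rewrite tF; apply: homogZ.
apply/funext => s; rewrite tF chiM mulrC -scalerA -tF //.
Qed.

(** Functions in the span of the bihomogeneous ones: as a graded space, the
    sum of copies of [C] indexed by the weights.  The map [coind_map] is one half
    of the adjunction; the other half is evaluation at [1]. *)
Record is_coinduced (R : tdga k r) (ev : R -> fun_pre) : Prop := IsCoinduced {
  coind_hom : @is_hom k r R fun_pre ev;
  coind_inj : injective ev;
  coind_elt : forall d F, bihom (X := fun_pre) d F ->
    exists2 z, bihom (X := R) d z & ev z = F;
  coind_map : forall (A : tdga k r) (u : dga_hom A C),
    exists h : tdga_hom A R, forall a t, ev (h a) t = u (tact A t a)
}.

Lemma coinduced_exists : exists R ev, @is_coinduced R ev.
Proof.
pose U := {d : nat * weight & {x : fun_pre | bihom d x}}.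
pose deg (e : U) := tag e.
have [P [oP [pi G]]] := generated_exists hk (deg := deg) (X := fun _ : unit => fun_pre)
  (o := fun _ e _ => sval (tagged e)) (fun _ e _ => svalP (tagged e)).
have elt d (x : fun_pre) : bihom d x -> exists2 z : P, bihom (X := P) d z & pi tt z = x.
  move=> hx; exists (oP (Tagged _ (exist _ x hx)) 0).
    exact: (gen_deg G (Tagged _ (exist _ x hx)) 0).
  by rewrite (gen_op G).
exists P, (pi tt); split=> //.
- exact: (gen_hom G tt).
- by move=> z z' E; apply: (gen_inj G) => -[].
- move=> A u.
  pose F (_ : unit) (a : A) : fun_pre := (fun t => u (tact A t a)) : fun_type.
  have hF i : @is_hom k r A fun_pre (F i).
    split.
    + move=> c a b; apply/funext => t; rewrite /F (dga_funL (tact A t)).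
      by rewrite [LHS](dga_funL u).
    + by apply/funext => t; rewrite /F !dga_fun1.
    + by move=> a b; apply/funext => t; rewrite /F !dga_funM.
    + by move=> n a ha t; do 2 apply: dga_fun_homog.
    + by move=> a; apply/funext => t; rewrite /F /= !dga_fun_diff.
    + by move=> s a; apply/funext => t; rewrite /F /= tactM.
  have [|h hh] := gen_factor hk (F := F) G hF.
    move=> d a /(is_hom_bihom (hF tt)) /elt [z _ hz].
    by exists z => -[].
  by exists h => a t; rewrite hh.
Qed.

End FunctionAlgebra.

(** A lifting problem in weight [w] is determined by its value at [1], hence
    is a lifting problem for [p], and the solution extends by [chi w]. *)
Lemma coinduced_acyclic_lifting (X Y : dga k) (p : dga_hom X Y)
    (RX RY : tdga k r) (eX : RX -> fun_pre X) (eY : RY -> fun_pre Y)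
    (q : tdga_hom RX RY) :
  is_coinduced eX -> is_coinduced eY -> (forall z t, eY (q z) t = p (eX z t)) ->
  fibration p -> weak_equivalence p -> acyclic_lifting q.
Proof.
move=> cX cY qE fp wp.
have constr n w x : homog n x ->
    exists2 z : RX, bihom (X := RX) (n, w) z & forall t, eX z t = chi w t *: x.
  move=> hx; have [|z hz Ez] := coind_elt cX (d := (n, w)) (F := fun t => chi w t *: x).
    by apply/fun_bihomE; split=> [|t]; [apply: homogZ|rewrite chi1 scale1r].
  by exists z => // t; rewrite Ez.
have ext n w (y y' : RY) : bihom (X := RY) (n, w) y -> bihom (X := RY) (n, w) y' ->
    eY y 1%g = eY y' 1%g -> y = y'.
  move=> /(is_hom_bihom (coind_hom cY)) /fun_bihomE [_ h].
  move=> /(is_hom_bihom (coind_hom cY)) /fun_bihomE [_ h'] E.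
  by apply: (coind_inj cY); apply/funext => t; rewrite h h' E.
have q_bihom n w z : bihom (X := RX) (n, w) z -> bihom (X := RY) (n, w) (q z).
  exact: (is_hom_bihom (tdga_is_hom q)).
split=> [w y hy|n w y x hy hx dx qx].
  have /fun_bihomE [hy1 _] := is_hom_bihom (coind_hom cY) hy.
  have [x hx px] := acyclic_fib_lift0 fp wp hy1.
  have [z hz Ez] := constr 0%N w x hx; exists z => //.
  by apply: (ext 0%N w) => //; [apply: q_bihom|rewrite qE Ez chi1 scale1r].
have /fun_bihomE [hy1 _] := is_hom_bihom (coind_hom cY) hy.
have /fun_bihomE [hx1 tx] := is_hom_bihom (coind_hom cX) hx.
have eXd z t : eX (dga_diff RX z) t = dga_diff X (eX z t).
  by have /= := congr1 (fun F : fun_type X => F t) (hom_diff (coind_hom cX) z).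
have eYd z t : eY (dga_diff RY z) t = dga_diff Y (eY z t).
  by have /= := congr1 (fun F : fun_type Y => F t) (hom_diff (coind_hom cY) z).
have [||x' [hx' dx' px']] := acyclic_fib_liftS fp wp hy1 hx1.
- by rewrite -eXd dx (lin0 (hom_lin (coind_hom cX))).
- by rewrite -qE qx eYd.
have [z hz Ez] := constr n.+1 w x' hx'; exists z; split=> //.
  by apply: (coind_inj cX); apply/funext => t; rewrite eXd Ez linearZ /= dx' -tx.
by apply: (ext n.+1 w) => //; [apply: q_bihom|rewrite qE Ez chi1 scale1r].
Qed.

(** Transpose the square along the adjunction, lift there, and evaluate at
    [1]. *)
Lemma forget_llp (A B : tdga k r) (f : tdga_hom A B) :
  (forall (X Y : tdga k r) (p : tdga_hom X Y) (u : tdga_hom A X) (v : tdga_hom B Y),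
     acyclic_lifting p -> (forall a, p (u a) = v (f a)) ->
     exists h : tdga_hom B X, (forall a, h (f a) = u a) /\ (forall b, p (h b) = v b)) ->
  forall (X Y : dga k) (p : dga_hom X Y) (u : dga_hom A X) (v : dga_hom B Y),
    fibration p -> weak_equivalence p -> (forall a, p (u a) = v (f a)) ->
    exists h : dga_hom B X, (forall a, h (f a) = u a) /\ (forall b, p (h b) = v b).
Proof.
move=> Hf X Y p u v fp wp sq.
have [RX [eX cX]] := coinduced_exists X; have [RY [eY cY]] := coinduced_exists Y.
have hev : exists e1 : dga_hom RX X, forall z, e1 z = eX z 1%g.
  have [l1 l2 l3 l4 l5 _] := coind_hom cX.
  have hL : linear (fun z : RX => eX z 1%g) by move=> a x y; rewrite l1.
  have h1 : eX (aone RX) 1%g = aone X by rewrite [eX _]l2.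
  have hM x y : eX (x ** y) 1%g = eX x 1%g ** eX y 1%g by rewrite [eX _]l3.
  have hH n (x : RX) : homog n x -> homog n (eX x 1%g) by move=> hx; apply: l4 hx 1%g.
  have hD (x : RX) : eX (dga_diff RX x) 1%g = dga_diff X (eX x 1%g) by rewrite [eX _]l5.
  by exists (DgaHom (A := RX) hL h1 hM hH hD).
have [e1 e1E] := hev.
have [q qE] : exists q : tdga_hom RX RY, forall z t, eY (q z) t = p (eX z t).
  have [q hq] := coind_map cY (dga_comp p e1); exists q => z t.
  rewrite hq /= e1E; congr (p _).
  have := congr1 (fun F : fun_type X => F 1%g) (hom_act (coind_hom cX) t z) => /= ->.
  by rewrite mul1g.
have [u' hu'] := coind_map cX u; have [v' hv'] := coind_map cY v.
have [||h [hj hp]] := Hf RX RY q u' v'.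
- exact: (coinduced_acyclic_lifting cX cY qE fp wp).
- move=> a; apply: (coind_inj cY); apply/funext => t.
  by rewrite qE hu' hv' sq -tdga_funT.
exists (dga_comp e1 h); split=> [a|b] /=; rewrite e1E.
  by rewrite hj hu' tact1.
by rewrite -qE hp hv' tact1.
Qed.

End Coinduction.

(** * The model structure *)

Section CategoryFacts.
Variable C : category.

Lemma llp_wide (P : morphism_class C) : wide_subcategory (llp P).
Proof.
split=> [X Y Y' p _ u v sq|X Y Z g f Hg Hf X' Y' p Pp u v sq].
  by exists u; rewrite mcompm1 sq mcompm1.
have [h1 [h1f ph1]] := Hf _ _ _ Pp u (v \c g) (etrans sq (mcompA _ _ _)).
have [h2 [h2g ph2]] := Hg _ _ _ Pp h1 v ph1.
by exists h2; rewrite mcompA h2g.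
Qed.

Lemma retract_lifts (A B A' B' X Y : C) (f : mor A B) (g : mor A' B') (p : mor X Y) :
  retract_of f g -> lifts g p -> lifts f p.
Proof.
move=> [i [s [j [t [ri sj gi fr]]]]] Lg u v sq.
have [|h [hg ph]] := Lg (u \c s) (v \c t).
  by rewrite mcompA sq -!mcompA fr.
exists (h \c j); split.
  by rewrite -mcompA -gi mcompA hg -mcompA ri mcompm1.
by rewrite mcompA ph -mcompA sj mcompm1.
Qed.

Lemma llp_retract (P : morphism_class C) : retract_closed (llp P).
Proof. by move=> X Y X' Y' f g fg Hg A B p Pp; apply: retract_lifts fg (Hg _ _ _ Pp). Qed.

(** The retract argument. *)
Lemma lifts_retract (X Y Z : C) (i : mor X Y) (j : mor X Z) (q : mor Z Y) :
  q \c j = i -> lifts i q -> retract_of i j.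
Proof.
move=> qj Lq; have [|h [hi qh]] := Lq j (idm Y); first by rewrite mcomp1m.
by exists (idm X), (idm X), h, q; rewrite !mcompm1.
Qed.

End CategoryFacts.

Section PreimageClass.
Variables (C D : category) (F : functor C D) (P : morphism_class D).

Definition preimage_class : morphism_class C := fun X Y f => P (fmap F f).

Lemma preimage_wide : wide_subcategory P -> wide_subcategory preimage_class.
Proof.
move=> [P1 PM]; split=> [X|X Y Z g f Pg Pf]; first by rewrite /preimage_class fmap1.
by rewrite /preimage_class fmapM; apply: PM.
Qed.

Lemma preimage_two_of_three : two_of_three P -> two_of_three preimage_class.
Proof.
by move=> H X Y Z g f; rewrite /preimage_class fmapM; apply: H.
Qed.

Lemma preimage_retract : retract_closed P -> retract_closed preimage_class.
Proof.
move=> H X Y X' Y' f g [i [s [j [t [ri sj gi fr]]]]]; apply: H.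
exists (fmap F i), (fmap F s), (fmap F j), (fmap F t).
by rewrite -!fmapM ri sj gi fr !fmap1.
Qed.

End PreimageClass.

Section DgaClasses.
Variable k : fieldType.
Implicit Types A B : dga k.

Lemma boundaryD A n (x y : A) : dga_boundary n x -> dga_boundary n y -> dga_boundary n (x + y).
Proof. by move=> [u hu <-] [v hv <-]; exists (u + v); [apply: homogD|rewrite linearD]. Qed.
Lemma boundaryB A n (x y : A) : dga_boundary n x -> dga_boundary n y -> dga_boundary n (x - y).
Proof. by move=> [u hu <-] [v hv <-]; exists (u - v); [apply: homogB|rewrite linearB]. Qed.
Lemma cycleB A n (x y : A) : dga_cycle n x -> dga_cycle n y -> dga_cycle n (x - y).
Proof.
by move=> [hx dx] [hy dy]; split; [apply: homogB|rewrite linearB dx dy subrr].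
Qed.
Lemma boundary_hom A B (f : dga_hom A B) n x : dga_boundary n x -> dga_boundary n (f x).
Proof. by move=> [u hu <-]; exists (f u); [apply: dga_fun_homog|rewrite dga_fun_diff]. Qed.
Lemma cycle_hom A B (f : dga_hom A B) n x : dga_cycle n x -> dga_cycle n (f x).
Proof.
move=> [hx dx]; split; first exact: dga_fun_homog.
by rewrite -dga_fun_diff dx (lin0 (dga_funL f)).
Qed.

Lemma dga_hom_app A B (f g : dga_hom A B) : f = g -> forall x, f x = g x.
Proof. by move=> ->. Qed.

Lemma dga_weq_two_of_three : two_of_three (@dga_weq k).
Proof.
move=> X Y Z; rewrite /DGA /= in X Y Z * => g f; split=> H1 H2 n.
- have [i1 s1] := H1 n; have [i2 s2] := H2 n; split=> [x cx bx|z cz].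
    by apply: i1 => //; apply: i2 => //; apply: cycle_hom.
  have [y cy by'] := s2 z cz; have [x cx bx] := s1 y cy; exists x => //.
  have := boundaryD (boundary_hom g bx) by'.
  by rewrite (linB (dga_funL g)) addrA subrK; apply.
- have [i1 s1] := H1 n; have [i2 s2] := H2 n; split=> [y cy bgy|z /s2 [x cx bx]].
    have [x cx bx] := s1 y cy.
    have bgfx : dga_boundary n (g (f x)).
      have := boundaryD (boundary_hom g bx) bgy.
      by rewrite (linB (dga_funL g)) subrK.
    have := boundaryB (boundary_hom f (i2 x cx bgfx)) bx.
    by rewrite opprB addrC subrK.
  by exists (f x) => //; apply: cycle_hom.
- have [i1 s1] := H1 n; have [i2 s2] := H2 n; split=> [x cx bx|y cy].
    by apply: i2 => //; apply: (boundary_hom g bx).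
  have [x cx bx] := s2 (g y) (cycle_hom g cy); exists x => //.
  apply: i1; first by apply: cycleB => //; apply: cycle_hom.
  by rewrite (linB (dga_funL g)).
Qed.

Lemma dga_weq_wide : wide_subcategory (@dga_weq k).
Proof.
split=> [X n|X Y Z g f Pg Pf]; last by have [H _ _] := dga_weq_two_of_three g f; apply: H.
by split=> // y cy; exists y => //=; rewrite subrr; apply: boundary0.
Qed.

Lemma dga_weq_retract : retract_closed (@dga_weq k).
Proof.
move=> X Y X' Y'; rewrite /DGA /= in X Y X' Y' * => f g.
move=> [i [s [j [t [/dga_hom_app si /dga_hom_app tj /dga_hom_app gi /dga_hom_app fs]]]]].
rewrite /= in si tj gi fs.
move=> Hg n; have [inj surj] := Hg n; split=> [x cx bx|y cy].
  rewrite -(si x); apply: boundary_hom; apply: inj; first exact: cycle_hom.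
  by rewrite gi; apply: boundary_hom.
have [x' cx' bx'] := surj (j y) (cycle_hom j cy).
exists (s x'); first exact: cycle_hom.
have := boundary_hom t bx'.
by rewrite (linB (dga_funL t)) tj -fs.
Qed.

Lemma dga_fib_wide : wide_subcategory (@dga_fib k).
Proof.
split=> [X n _ y hy|X Y Z g f Pg Pf n n0 z hz]; first by exists y.
have [y hy <-] := Pg n n0 z hz; have [x hx <-] := Pf n n0 y hy.
by exists x.
Qed.

Lemma dga_fib_retract : retract_closed (@dga_fib k).
Proof.
move=> X Y X' Y'; rewrite /DGA /= in X Y X' Y' * => f g.
move=> [i [s [j [t [/dga_hom_app si /dga_hom_app tj /dga_hom_app gi /dga_hom_app fs]]]]].
rewrite /= in si tj gi fs.
move=> Hg n n0 y hy; have [x' hx' Ex'] := Hg n n0 (j y) (dga_fun_homog j hy).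
exists (s x'); first exact: dga_fun_homog.
by rewrite fs Ex' tj.
Qed.

End DgaClasses.

Section Equivariant.
Variables (k : fieldType) (hk : [pchar k] =i pred0) (r : nat).

Definition weqT : morphism_class (DGAT k r) := preimage_class (forgetT k r) (@dga_weq k).
Definition fibT : morphism_class (DGAT k r) := preimage_class (forgetT k r) (@dga_fib k).
Definition cofT : morphism_class (DGAT k r) := llp (meet_class fibT weqT).

Lemma tdga_hom_app (A B : tdga k r) (f g : tdga_hom A B) : f = g -> forall x, f x = g x.
Proof. by move=> ->. Qed.

Lemma lifts_pointwise (A B X Y : tdga k r) (i : tdga_hom A B) (p : tdga_hom X Y) :
  @lifts (DGAT k r) A B X Y i p <->
  forall (u : tdga_hom A X) (v : tdga_hom B Y), (forall a, p (u a) = v (i a)) ->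
    exists h : tdga_hom B X, (forall a, h (i a) = u a) /\ (forall b, p (h b) = v b).
Proof.
split=> H u v sq.
  have [|h [/tdga_hom_app hi /tdga_hom_app ph]] := H u v; first exact: hom_tdgaP.
  by exists h.
have [|h [hi ph]] := H u v; first exact: (tdga_hom_app sq).
by exists h; split; apply: hom_tdgaP.
Qed.

Lemma acyclic_fibP (X Y : tdga k r) (p : tdga_hom X Y) :
  meet_class fibT weqT p <-> acyclic_lifting p.
Proof.
split=> [[fp wp]|lp]; first exact: acyclic_fib_lifting.
by split; [apply: acyclic_lifting_fib|apply: acyclic_lifting_weq].
Qed.

Lemma cof_acyclic_fib_factors : factors cofT (meet_class fibT weqT).
Proof.
move=> A B f; have [Z [j [q [qj lq H]]]] := cofibration_factorization hk f.
exists Z, j, q; split; [|exact/acyclic_fibP|exact: hom_tdgaP].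
by move=> X Y p /acyclic_fibP lp; apply/lifts_pointwise => u v; apply: H.
Qed.

(** Lifting against all fibrations passes to retracts, hence will hold for
    every acyclic cofibration. *)
Lemma acyclic_cof_factorsT (A B : tdga k r) (f : tdga_hom A B) :
  exists (Z : DGAT k r) (j : mor (A : DGAT k r) Z) (q : mor Z (B : DGAT k r)),
  [/\ llp fibT j, weqT j, fibT q & q \c j = f].
Proof.
have [Z [j [q [qj fq wj H]]]] := acyclic_cofibration_factorization hk f.
exists Z, j, q; split=> //; last exact: hom_tdgaP.
by move=> X Y p fp; apply/lifts_pointwise => u v; apply: H.
Qed.

Lemma acyclic_cof_fib_factors : factors (meet_class cofT weqT) fibT.
Proof.
move=> A B f; have [Z [j [q [lj wj fq qj]]]] := acyclic_cof_factorsT f.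
exists Z, j, q; split=> //; split=> // X Y p [fp _]; exact: lj.
Qed.

(** Factor [i] as a map [j] with the lifting property against fibrations
    followed by a fibration [q].  By two-out-of-three [q] is a weak equivalence,
    so [i] lifts against it and is a retract of [j]. *)
Lemma acyclic_cof_llp (A B : DGAT k r) (i : mor A B) :
  meet_class cofT weqT i -> llp fibT i.
Proof.
move=> [ci wi]; have [Z [j [q [lj wj fq qj]]]] := acyclic_cof_factorsT i.
apply: llp_retract lj; apply: (lifts_retract qj); apply: ci; split=> //.
have [_ H _] := preimage_two_of_three (forgetT k r) (@dga_weq_two_of_three k) q j.
by apply: H => //; rewrite qj.
Qed.

Definition equivariant_model_structure : model_structure (DGAT k r) :=
  @ModelStructure (DGAT k r) weqT fibT cofT (@dgat_complete k hk r) (@dgat_cocomplete k hk r)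
    (preimage_wide (forgetT k r) (@dga_weq_wide k))
    (preimage_wide (forgetT k r) (@dga_fib_wide k)) (@llp_wide _ _)
    (preimage_two_of_three (forgetT k r) (@dga_weq_two_of_three k))
    (@preimage_retract _ _ (forgetT k r) _ (@dga_weq_retract k))
    (@preimage_retract _ _ (forgetT k r) _ (@dga_fib_retract k))
    (@llp_retract _ _) (fun A B X Y i p ci fp => ci X Y p fp)
    (fun A B X Y i p ci fp => acyclic_cof_llp ci fp)
    cof_acyclic_fib_factors acyclic_cof_fib_factors.

Lemma forget_cof (A B : DGAT k r) (f : mor A B) : cofT f -> dga_cof (fmap (forgetT k r) f).
Proof.
move=> cf X Y p [fp wp] u v sq.
have [X' Y' p' u' v' lp' sq'|a|h [hf ph]] := forget_llp hk (f := f) _ fp wp (u := u) (v := v).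
- have /lifts_pointwise H := cf X' Y' p' ((acyclic_fibP p').2 lp').
  exact: H.
- exact: (dga_hom_app sq a).
by exists h; split; apply: dga_homP.
Qed.

End Equivariant.

Theorem theorem2p5p1 (k : closedFieldType) (hk : [pchar k]%R =i pred0) (r : nat) :
  exists M : model_structure (DGAT k r),
    [/\ forall (A B : DGAT k r) (f : mor A B),
          weq M f <-> dga_weq (fmap (forgetT k r) f),
        forall (A B : DGAT k r) (f : mor A B),
          fib M f <-> dga_fib (fmap (forgetT k r) f),
        forall (A B : DGAT k r) (f : mor A B),
          cof M f <-> llp (meet_class (@fib _ M) (@weq _ M)) f
      & forall (A B : DGAT k r) (f : mor A B),
          cof M f -> dga_cof (fmap (forgetT k r) f)].
Proof.
exists (equivariant_model_structure hk r); split=> // A B f.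
exact: forget_cof.
Qed.
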